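(* Consider the theory in the language $\{\times,{}^{-1},\mathbf 0,\mathbf 1,\mathbf{-1},\mathcal P\}$ with the following axioms, where $n$ ranges over all natural numbers $n\geq 1$: (M$_1$) $\forall x,y,z\,(x\cdot(y\cdot z)=(x\cdot y)\cdot z)$; (M$_2$) $\forall x\,(x\cdot\mathbf 1=x)$; (M$_3$) $\forall x\,(x\neq\mathbf 0\rightarrow x\cdot x^{-1}=\mathbf 1)$; (M$_4$) $\forall x,y\,(x\cdot y=y\cdot x)$; (M$_9^\diamond$) $\exists y\,(y\neq\mathbf{-1}\wedge y\neq\mathbf 0\wedge y\neq\mathbf 1)$; (M$_{10}$) $\forall x\,(x\cdot\mathbf 0=\mathbf 0=\mathbf 0^{-1})$; (M$_{11,n}$) $\forall x\,(x^{2n}=\mathbf 1\leftrightarrow x=\mathbf 1\vee x=\mathbf{-1})$; (M$_{12,n}$) $\forall x\,\exists y\,(x=y^{2n+1})$; (M$_{13}$) $\forall x\,(\mathcal P(x)\leftrightarrow\exists y[y\neq\mathbf 0\wedge x=y^2])$; (M$_{14}$) $\forall x\,(x\neq\mathbf 0\rightarrow[\neg\mathcal P(x)\leftrightarrow\mathcal P(-x)])$; (M$_{15}$) for all $x,y\neq\mathbf 0$: $\mathcal P(x\cdot y)\leftrightarrow[\mathcal P(x)\leftrightarrow\mathcal P(y)]$. This theory completely axiomatizes the structure $\langle\mathbb R;\times,{}^{-1},\mathbf 0,\mathbf 1,\mathbf{-1},\mathcal P\rangle$ and, moreover, its theory admits quantifier elimination, and so is decidable.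
   Context: In $\mathbb R$, $\mathcal P(y)$ means that $y$ is a positive real number, ${}^{-1}$ is the multiplicative inverse on nonzero elements, and by convention $0^{-1}=0$. $-x$ is a shorthand for $(\mathbf{-1})\cdot x$, and $x^n$ abbreviates $x\cdot x\cdots x$ ($n$ times). The symbols $\times$ and $\cdot$ are used interchangeably. A theory completely axiomatizes a structure if, for every first-order sentence of the language of the structure, the sentence is true in the structure if and only if it is provable from the theory. Quantifier elimination means that every formula of the language is equivalent, modulo the theory, to a quantifier-free formula of that language. A theory is decidable if there is an algorithm deciding whether a given sentence belongs to it. *)

(* Defs.v *)
From Stdlib Require Import Reals List Arith Relations.
Import ListNotations.

(** * First-order logic over the signature (x, ^-1, 0, 1, -1, P) *)

(** Variables are de Bruijn indices: [var n] refers to the [n]-th enclosing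
    quantifier, counted from the inside, or to a free variable. *)
Inductive term : Type :=
| var  : nat -> term
| zero : term
| one  : term
| mone : term
| mul  : term -> term -> term
| inv  : term -> term.

(** Equality is a logical symbol.  The other connectives are the usual
    classical abbreviations. *)
Inductive form : Type :=
| Pos : term -> form
| Eq  : term -> term -> form
| Bot : form
| Imp : form -> form -> form
| All : form -> form.

Definition Not (f : form) : form := Imp f Bot.
Definition And (f g : form) : form := Not (Imp f (Not g)).
Definition Or (f g : form) : form := Imp (Not f) g.
Definition Iff (f g : form) : form := And (Imp f g) (Imp g f).
Definition Ex (f : form) : form := Not (All (Not f)).
Definition Neq (s t : term) : form := Not (Eq s t).

Definition neg (t : term) : term := mul mone t.

(** [tpow t n] is t.t...t with [n] factors; only used for [n >= 1]. *)
Fixpoint tpow (t : term) (n : nat) : term :=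
  match n with
  | O => one
  | S O => t
  | S m => mul t (tpow t m)
  end.

(** ** Closedness and quantifier-freeness *)

Fixpoint term_closed_at (k : nat) (t : term) : Prop :=
  match t with
  | var n => n < k
  | zero | one | mone => True
  | mul s u => term_closed_at k s /\ term_closed_at k u
  | inv s => term_closed_at k s
  end.

Fixpoint closed_at (k : nat) (f : form) : Prop :=
  match f with
  | Pos t => term_closed_at k t
  | Eq s t => term_closed_at k s /\ term_closed_at k t
  | Bot => True
  | Imp g h => closed_at k g /\ closed_at k h
  | All g => closed_at (S k) g
  end.

Definition sentence (f : form) : Prop := closed_at 0 f.

Fixpoint quantifier_free (f : form) : Prop :=
  match f with
  | Pos _ | Eq _ _ | Bot => True
  | Imp g h => quantifier_free g /\ quantifier_free h
  | All _ => False
  end.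

(** ** Parallel substitution *)

Fixpoint tsubst (sigma : nat -> term) (t : term) : term :=
  match t with
  | var n => sigma n
  | zero => zero
  | one => one
  | mone => mone
  | mul s u => mul (tsubst sigma s) (tsubst sigma u)
  | inv s => inv (tsubst sigma s)
  end.

Definition shift (n : nat) : term := var (S n).

Definition scons (t : term) (sigma : nat -> term) (n : nat) : term :=
  match n with O => t | S m => sigma m end.

Definition up (sigma : nat -> term) : nat -> term :=
  scons (var 0) (fun n => tsubst shift (sigma n)).

Fixpoint fsubst (sigma : nat -> term) (f : form) : form :=
  match f with
  | Pos t => Pos (tsubst sigma t)
  | Eq s t => Eq (tsubst sigma s) (tsubst sigma t)
  | Bot => Bot
  | Imp g h => Imp (fsubst sigma g) (fsubst sigma h)
  | All g => All (fsubst (up sigma) g)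
  end.

Definition lift (f : form) : form := fsubst shift f.

(** [inst f t] replaces index 0 by [t] and lowers the other indices. *)
Definition inst (f : form) (t : term) : form := fsubst (scons t var) f.

(** ** Classical natural deduction with equality *)

Inductive prv : list form -> form -> Prop :=
| prv_ctx A f : In f A -> prv A f
| prv_impI A f g : prv (f :: A) g -> prv A (Imp f g)
| prv_impE A f g : prv A (Imp f g) -> prv A f -> prv A g
| prv_contra A f : prv (Not f :: A) Bot -> prv A f
| prv_allI A f : prv (map lift A) f -> prv A (All f)
| prv_allE A f t : prv A (All f) -> prv A (inst f t)
| prv_eqI A t : prv A (Eq t t)
| prv_eqE A f s t : prv A (Eq s t) -> prv A (inst f s) -> prv A (inst f t).

Definition theory : Type := form -> Prop.

Definition proves (T : theory) (f : form) : Prop :=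
  exists A : list form, (forall g, In g A -> T g) /\ prv A f.

(** ** Structures and satisfaction *)

Record structure : Type := Structure {
  carrier :> Type;
  i_zero : carrier;
  i_one  : carrier;
  i_mone : carrier;
  i_mul  : carrier -> carrier -> carrier;
  i_inv  : carrier -> carrier;
  i_pos  : carrier -> Prop
}.

Fixpoint eval (M : structure) (rho : nat -> M) (t : term) : M :=
  match t with
  | var n => rho n
  | zero => i_zero M
  | one => i_one M
  | mone => i_mone M
  | mul s u => i_mul M (eval M rho s) (eval M rho u)
  | inv s => i_inv M (eval M rho s)
  end.

Definition econs (M : structure) (a : M) (rho : nat -> M) (n : nat) : M :=
  match n with O => a | S m => rho m end.

Fixpoint sat (M : structure) (rho : nat -> M) (f : form) : Prop :=
  match f with
  | Pos t => i_pos M (eval M rho t)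
  | Eq s t => eval M rho s = eval M rho t
  | Bot => False
  | Imp g h => sat M rho g -> sat M rho h
  | All g => forall a : M, sat M (econs M a rho) g
  end.

Definition models (M : structure) (f : form) : Prop :=
  forall rho : nat -> M, sat M rho f.

(** ** Complete axiomatization and quantifier elimination *)

Definition completely_axiomatizes (T : theory) (M : structure) : Prop :=
  forall f, sentence f -> (models M f <-> proves T f).

Definition admits_QE (T : theory) : Prop :=
  forall f, exists g, quantifier_free g /\ proves T (Iff f g).

(** * Decidability

    Algorithms are closed terms of the weak call-by-value lambda-calculus, a
    Turing-complete model of computation; formulas are given to them in Scott
    encoding.  (Mere boolean decidability inside the logic would be void, as
    the classical axioms make every predicate decidable in that sense.) *)

Inductive lterm : Type :=
| lvar : nat -> lterm
| lapp : lterm -> lterm -> lterm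
| llam : lterm -> lterm.

Fixpoint lclosed_at (k : nat) (s : lterm) : Prop :=
  match s with
  | lvar n => n < k
  | lapp t u => lclosed_at k t /\ lclosed_at k u
  | llam t => lclosed_at (S k) t
  end.

Definition lclosed (s : lterm) : Prop := lclosed_at 0 s.

(** Does not shift [u]: correct because only closed terms are ever reduced. *)
Fixpoint lsubst (s : lterm) (k : nat) (u : lterm) : lterm :=
  match s with
  | lvar n => if Nat.eqb n k then u else lvar n
  | lapp t v => lapp (lsubst t k u) (lsubst v k u)
  | llam t => llam (lsubst t (S k) u)
  end.

Inductive lstep : lterm -> lterm -> Prop :=
| lstep_beta s t : lstep (lapp (llam s) (llam t)) (lsubst s 0 (llam t))
| lstep_appL s s' t : lstep s s' -> lstep (lapp s t) (lapp s' t)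
| lstep_appR s t t' : lstep t t' -> lstep (lapp s t) (lapp s t').

Definition lreduces : lterm -> lterm -> Prop := clos_refl_trans lterm lstep.

(** The [i]-th of [k] constructors applied to closed terms [a1 ... am] is
    encoded as [fun c_0 ... c_(k-1) => c_i a1 ... am]. *)
Definition scott (k i : nat) (args : list lterm) : lterm :=
  Nat.iter k llam (fold_left lapp args (lvar (k - 1 - i))).

Definition ltrue : lterm := scott 2 0 [].
Definition lfalse : lterm := scott 2 1 [].

Fixpoint enc_nat (n : nat) : lterm :=
  match n with
  | O => scott 2 0 []
  | S m => scott 2 1 [enc_nat m]
  end.

Fixpoint enc_term (t : term) : lterm :=
  match t with
  | var n => scott 6 0 [enc_nat n]
  | zero => scott 6 1 []
  | one => scott 6 2 []
  | mone => scott 6 3 []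
  | mul s u => scott 6 4 [enc_term s; enc_term u]
  | inv s => scott 6 5 [enc_term s]
  end.

Fixpoint enc_form (f : form) : lterm :=
  match f with
  | Pos t => scott 5 0 [enc_term t]
  | Eq s t => scott 5 1 [enc_term s; enc_term t]
  | Bot => scott 5 2 []
  | Imp g h => scott 5 3 [enc_form g; enc_form h]
  | All g => scott 5 4 [enc_form g]
  end.

Definition decidable_theory (T : theory) : Prop :=
  exists d : lterm, lclosed d /\
    forall f, sentence f ->
      (proves T f -> lreduces (lapp d (enc_form f)) ltrue) /\
      (~ proves T f -> lreduces (lapp d (enc_form f)) lfalse).

(** * The multiplicative theory of the real numbers *)

(** In Stdlib [Rinv 0 = 0] ([Rinv_0]), which is the convention wanted here. *)
Definition R_struct : structure :=
  Structure R 0%R 1%R (-1)%R Rmult Rinv (fun y => (0 < y)%R).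

Declare Scope fol_scope.
Delimit Scope fol_scope with fol.
Bind Scope fol_scope with term form.
Local Notation "s ** t" := (mul s t) (at level 40, left associativity) : fol_scope.
Local Notation "s == t" := (Eq s t) (at level 70, no associativity) : fol_scope.
Local Notation "s != t" := (Neq s t) (at level 70, no associativity) : fol_scope.
Local Notation "! f" := (Not f) (at level 75, right associativity) : fol_scope.
Local Notation "f --> g" := (Imp f g) (at level 85, right associativity) : fol_scope.
Local Notation "f <--> g" := (Iff f g) (at level 90, no associativity) : fol_scope.

Local Open Scope fol_scope.
Local Notation v0 := (var 0).
Local Notation v1 := (var 1).
Local Notation v2 := (var 2).

(** With several leading quantifiers, x is the outermost (highest index). *)
Inductive mul_axioms : theory :=
| ax_mul_assoc :
    mul_axioms (All (All (All (v2 ** (v1 ** v0) == (v2 ** v1) ** v0))))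
| ax_mul_one :
    mul_axioms (All (v0 ** one == v0))
| ax_mul_inv :
    mul_axioms (All ((v0 != zero) --> (v0 ** inv v0 == one)))
| ax_mul_comm :
    mul_axioms (All (All (v1 ** v0 == v0 ** v1)))
| ax_nontrivial :
    mul_axioms (Ex (And (v0 != mone) (And (v0 != zero) (v0 != one))))
| ax_zero :
    mul_axioms (All (And (v0 ** zero == zero) (zero == inv zero)))
| ax_even_roots (n : nat) : 1 <= n ->
    mul_axioms (All ((tpow v0 (2 * n) == one)
                     <--> Or (v0 == one) (v0 == mone)))
| ax_odd_roots (n : nat) : 1 <= n ->
    mul_axioms (All (Ex (v1 == tpow v0 (2 * n + 1))))
| ax_pos_square :
    mul_axioms (All (Pos v0
                     <--> Ex (And (v0 != zero) (v1 == tpow v0 2))))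
| ax_pos_neg :
    mul_axioms (All ((v0 != zero) --> (! Pos v0 <--> Pos (neg v0))))
| ax_pos_mul :
    mul_axioms (All (All (And (v1 != zero) (v0 != zero)
                     --> (Pos (v1 ** v0) <--> (Pos v1 <--> Pos v0))))).

(* Main.v *)
From Stdlib Require Import Reals List Arith Lia Lra ZArith Relations String.
From Stdlib Require Import Classical ClassicalEpsilon FunctionalExtensionality
  PropExtensionality ProofIrrelevance Cantor Setoid Morphisms.
Require Import Defs.
Import ListNotations.

(** Taking logarithms of absolute values turns a model of the axioms into a
    zero element together with two copies, one for each sign, of its group of
    positive elements.  This group is torsion-free, because 1 and -1 are the
    only roots of unity, divisible, because positive elements have square roots
    and all elements have odd roots, and nontrivial; that is, it is a nonzero
    vector space over the rationals ([model_presentation]).  An atomic formula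
    then speaks of the zeros and the signs of its variables, and of one linear
    relation with integer coefficients between their logarithms.

    Everything rests on one back-and-forth argument ([related_extend]).  Let two
    tuples satisfy the same integer relations with coefficients up to [2 * N * N].
    For every further element on one side there is one on the other such that
    the longer tuples satisfy the same relations with coefficients up to [N]: if
    the new element satisfies such a relation, solve that relation on the other
    side and eliminate; otherwise choose an element that satisfies none.  Hence
    the truth value of a formula depends only on the zeros and signs of its
    parameters and on finitely many relations between them, and this dependence
    is the same in all models.

    The argument applies as well with the integers on one side, although they
    are not divisible: multiplying a tuple by a large factorial changes none of
    its relations and makes all required solutions integral, and the solutions
    and a generic integer are explicitly bounded.  Thus a quantifier may be
    replaced by a finite search, and [ev] evaluates every formula in this way
    ([ev_sat]).

    The three claims follow.  A sentence has the value computed by [ev] in every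
    model of the axioms, the reals included; by Goedel's completeness theorem
    for the deduction system ([completeness], proved by Henkin's method) it is
    therefore provable if and only if it holds in the reals.  A formula with
    parameters is determined by finitely many quantifier-free formulas, so it is
    equivalent in all models, hence provably, to a Boolean combination of them
    ([definable_by_finite_list]).  Finally [ev] is programmed in the
    lambda-calculus ([lev_spec]), which decides the theory. *)

(** * Substitution and satisfaction *)

Lemma tsubst_ext_on k t sigma tau :
  term_closed_at k t -> (forall n, n < k -> sigma n = tau n) ->
  tsubst sigma t = tsubst tau t.
Proof.
  intros Ht H; induction t; simpl in *; f_equal; try tauto; auto.
Qed.

Lemma up_ext_on k sigma tau :
  (forall n, n < k -> sigma n = tau n) ->
  forall n, n < S k -> up sigma n = up tau n.
Proof.
  intros H [|n] Hn; simpl; auto. rewrite H by lia. reflexivity.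
Qed.

Lemma fsubst_ext_on f : forall k sigma tau,
  closed_at k f -> (forall n, n < k -> sigma n = tau n) ->
  fsubst sigma f = fsubst tau f.
Proof.
  induction f; intros k sigma tau Hf H; simpl in *; try destruct Hf; f_equal;
    eauto using tsubst_ext_on.
  eapply IHf; eauto. apply up_ext_on; auto.
Qed.

Lemma fsubst_ext f sigma tau :
  (forall n, sigma n = tau n) -> fsubst sigma f = fsubst tau f.
Proof.
  intros H. replace tau with sigma; auto. apply functional_extensionality, H.
Qed.

Lemma tsubst_id t : tsubst var t = t.
Proof. induction t; simpl; congruence. Qed.

Lemma fsubst_id f : fsubst var f = f.
Proof.
  induction f; simpl; rewrite ?tsubst_id; try congruence.
  f_equal. rewrite <- IHf at 2. apply fsubst_ext. intros [|n]; reflexivity.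
Qed.

Lemma tsubst_comp sigma tau t :
  tsubst tau (tsubst sigma t) = tsubst (fun n => tsubst tau (sigma n)) t.
Proof. induction t; simpl; congruence. Qed.

Lemma up_comp sigma tau n :
  tsubst (up tau) (up sigma n) = up (fun k => tsubst tau (sigma k)) n.
Proof.
  destruct n; simpl; auto. rewrite !tsubst_comp. reflexivity.
Qed.

Lemma fsubst_comp f : forall sigma tau,
  fsubst tau (fsubst sigma f) = fsubst (fun n => tsubst tau (sigma n)) f.
Proof.
  induction f; intros; simpl; rewrite ?tsubst_comp, ?IHf1, ?IHf2; try reflexivity.
  f_equal. rewrite IHf. apply fsubst_ext, up_comp.
Qed.

Lemma fsubst_lift sigma f : fsubst (up sigma) (lift f) = lift (fsubst sigma f).
Proof. unfold lift. rewrite !fsubst_comp. reflexivity. Qed.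

Lemma inst_fsubst_up sigma f t : inst (fsubst (up sigma) f) t = fsubst (scons t sigma) f.
Proof.
  unfold inst. rewrite fsubst_comp. apply fsubst_ext. intros [|n]; simpl; auto.
  rewrite tsubst_comp. apply tsubst_id.
Qed.

Lemma fsubst_inst sigma f t :
  fsubst sigma (inst f t) = inst (fsubst (up sigma) f) (tsubst sigma t).
Proof.
  rewrite inst_fsubst_up. unfold inst. rewrite fsubst_comp.
  apply fsubst_ext. intros [|n]; reflexivity.
Qed.

(** ** Every formula has finitely many free variables *)

Lemma term_closed_at_mono t k l : k <= l -> term_closed_at k t -> term_closed_at l t.
Proof. induction t; simpl; intuition lia. Qed.

Lemma closed_at_mono f : forall k l, k <= l -> closed_at k f -> closed_at l f.
Proof.
  induction f; simpl; intros k l Hkl H; intuition eauto using term_closed_at_mono.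
  eapply IHf; [|eauto]. lia.
Qed.

Fixpoint term_bound (t : term) : nat :=
  match t with
  | var n => S n
  | zero | one | mone => 0
  | mul s u => max (term_bound s) (term_bound u)
  | inv s => term_bound s
  end.

Fixpoint form_bound (f : form) : nat :=
  match f with
  | Pos t => term_bound t
  | Eq s t => max (term_bound s) (term_bound t)
  | Bot => 0
  | Imp g h => max (form_bound g) (form_bound h)
  | All g => pred (form_bound g)
  end.

Lemma term_bound_closed t : term_closed_at (term_bound t) t.
Proof.
  induction t; simpl; auto.
  split; [eapply term_closed_at_mono; [|exact IHt1]|
          eapply term_closed_at_mono; [|exact IHt2]]; lia.
Qed.

Lemma form_bound_closed f : closed_at (form_bound f) f.
Proof.
  induction f; simpl; auto using term_bound_closed.
  - split; eapply term_closed_at_mono; try apply term_bound_closed; lia.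
  - split; [eapply closed_at_mono; [|exact IHf1]|eapply closed_at_mono; [|exact IHf2]]; lia.
  - eapply closed_at_mono; [|exact IHf]; lia.
Qed.

Lemma tsubst_closed_at k l t sigma :
  term_closed_at k t -> (forall n, n < k -> term_closed_at l (sigma n)) ->
  term_closed_at l (tsubst sigma t).
Proof. induction t; simpl; intuition auto. Qed.

Lemma fsubst_closed_at f : forall k l sigma,
  closed_at k f -> (forall n, n < k -> term_closed_at l (sigma n)) ->
  closed_at l (fsubst sigma f).
Proof.
  induction f; simpl; intros k l sigma Hf H; intuition eauto using tsubst_closed_at.
  eapply IHf; eauto. intros [|n] Hn; simpl; [lia|].
  eapply tsubst_closed_at; [apply H; lia|]. unfold shift; simpl; lia.
Qed.

(** ** Satisfaction *)

Lemma eval_ext_on (M : structure) k t (rho tau : nat -> M) :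
  term_closed_at k t -> (forall n, n < k -> rho n = tau n) ->
  eval M rho t = eval M tau t.
Proof. intros Ht H; induction t; simpl in *; f_equal; try tauto; auto. Qed.

Lemma sat_ext_on (M : structure) f : forall k (rho tau : nat -> M),
  closed_at k f -> (forall n, n < k -> rho n = tau n) ->
  sat M rho f <-> sat M tau f.
Proof.
  induction f; intros k rho tau Hf H; simpl in *.
  - rewrite (eval_ext_on M k t rho tau); tauto.
  - rewrite (eval_ext_on M k t rho tau), (eval_ext_on M k t0 rho tau); tauto.
  - tauto.
  - rewrite (IHf1 k rho tau), (IHf2 k rho tau); tauto.
  - assert (E : forall a, sat M (econs M a rho) f <-> sat M (econs M a tau) f).
    { intros a. apply IHf with (k := S k); auto.
      intros [|n] Hn; simpl; auto. apply H; lia. }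
    split; intros G a; apply E; auto.
Qed.

Lemma sat_ext (M : structure) f (rho tau : nat -> M) :
  (forall n, rho n = tau n) -> sat M rho f <-> sat M tau f.
Proof.
  intros H. eapply sat_ext_on with (k := form_bound f);
    auto using form_bound_closed.
Qed.

Lemma sat_sentence (M : structure) f (rho : nat -> M) :
  sentence f -> sat M rho f -> models M f.
Proof.
  intros Hf H tau. eapply sat_ext_on; [exact Hf| |exact H]. lia.
Qed.

Lemma eval_tsubst (M : structure) sigma t (rho : nat -> M) :
  eval M rho (tsubst sigma t) = eval M (fun n => eval M rho (sigma n)) t.
Proof. induction t; simpl; congruence. Qed.

Lemma sat_fsubst (M : structure) f : forall sigma (rho : nat -> M),
  sat M rho (fsubst sigma f) <-> sat M (fun n => eval M rho (sigma n)) f.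
Proof.
  induction f; intros; simpl; rewrite ?eval_tsubst; try tauto.
  - rewrite IHf1, IHf2; tauto.
  - assert (E : forall a, sat M (econs M a rho) (fsubst (up sigma) f) <->
       sat M (econs M a (fun n => eval M rho (sigma n))) f).
    { intros a. rewrite IHf. apply sat_ext. intros [|n]; simpl; auto.
      rewrite eval_tsubst. reflexivity. }
    split; intros H a; apply E; auto.
Qed.

Lemma sat_lift (M : structure) f a (rho : nat -> M) :
  sat M (econs M a rho) (lift f) <-> sat M rho f.
Proof. unfold lift. rewrite sat_fsubst. reflexivity. Qed.

Lemma sat_inst (M : structure) f t (rho : nat -> M) :
  sat M rho (inst f t) <-> sat M (econs M (eval M rho t) rho) f.
Proof.
  unfold inst. rewrite sat_fsubst. apply sat_ext. intros [|n]; reflexivity.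
Qed.

Lemma sat_And M rho f g : sat M rho (And f g) <-> sat M rho f /\ sat M rho g.
Proof. simpl. tauto. Qed.

Lemma sat_Or M rho f g : sat M rho (Or f g) <-> sat M rho f \/ sat M rho g.
Proof. simpl. tauto. Qed.

Lemma sat_Iff M rho f g : sat M rho (Iff f g) <-> (sat M rho f <-> sat M rho g).
Proof. simpl. tauto. Qed.

Lemma sat_Ex M rho f : sat M rho (Ex f) <-> exists a, sat M (econs M a rho) f.
Proof.
  simpl. split.
  - intros H. apply NNPP. intros N. apply H. intros a Ha. apply N. eauto.
  - intros [a Ha] H. exact (H a Ha).
Qed.

Lemma soundness A f : prv A f ->
  forall (M : structure) rho, (forall g, In g A -> sat M rho g) -> sat M rho f.
Proof.
  induction 1; intros M rho HA.
  - auto.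
  - intros Hf. apply IHprv. intros h [<-|Hh]; auto.
  - exact (IHprv1 M rho HA (IHprv2 M rho HA)).
  - apply NNPP. intros N. apply (IHprv M rho). intros h [<-|Hh]; auto.
  - intros a. apply IHprv. intros g Hg. apply in_map_iff in Hg as (h & <- & Hh).
    apply sat_lift. auto.
  - apply sat_inst. apply (IHprv M rho HA).
  - reflexivity.
  - specialize (IHprv1 M rho HA). specialize (IHprv2 M rho HA). simpl in IHprv1.
    rewrite sat_inst in *. rewrite <- IHprv1. assumption.
Qed.

(** * Completeness of natural deduction *)

Lemma prv_weak A f : prv A f -> forall B, incl A B -> prv B f.
Proof.
  induction 1; intros B HB.
  - apply prv_ctx; auto.
  - apply prv_impI, IHprv. apply incl_cons; simpl; auto using incl_tl.
  - eapply prv_impE; eauto.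
  - apply prv_contra, IHprv. apply incl_cons; simpl; auto using incl_tl.
  - apply prv_allI, IHprv. apply incl_map, HB.
  - apply prv_allE; auto.
  - apply prv_eqI.
  - eapply prv_eqE; eauto.
Qed.

Lemma prv_subst A f : prv A f ->
  forall sigma, prv (map (fsubst sigma) A) (fsubst sigma f).
Proof.
  induction 1; intros sigma; simpl in *.
  - apply prv_ctx, in_map, H.
  - apply prv_impI, IHprv.
  - eapply prv_impE; [apply IHprv1|apply IHprv2].
  - apply prv_contra, IHprv.
  - apply prv_allI. specialize (IHprv (up sigma)).
    rewrite map_map in *. erewrite map_ext; [exact IHprv|].
    intros; simpl. symmetry. apply fsubst_lift.
  - rewrite fsubst_inst. apply prv_allE, IHprv.
  - apply prv_eqI.
  - rewrite fsubst_inst in *. eapply prv_eqE; [apply IHprv1|].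
    specialize (IHprv2 sigma). rewrite fsubst_inst in IHprv2. exact IHprv2.
Qed.

(** A variable that does not occur in the hypotheses is arbitrary: the
    substitution that sends it to index 0 and shifts all others acts on the
    hypotheses as [lift] and turns the instance back into [f]. *)
Lemma prv_generalize k A f :
  (forall g, In g A -> closed_at k g) -> closed_at (S k) f ->
  prv A (inst f (var k)) -> prv A (All f).
Proof.
  intros HA Hf H. apply prv_allI.
  set (sigma := fun n => if Nat.eqb n k then var 0 else var (S n)).
  apply prv_subst with (sigma := sigma) in H.
  replace (map lift A) with (map (fsubst sigma) A).
  2:{ apply map_ext_in. intros g Hg. eapply fsubst_ext_on; [apply HA, Hg|].
      intros n Hn. unfold sigma. destruct (Nat.eqb_spec n k); [lia|reflexivity]. }
  replace f with (fsubst sigma (inst f (var k))); auto.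
  unfold inst. rewrite fsubst_comp. rewrite <- (fsubst_id f) at 2.
  eapply fsubst_ext_on; [exact Hf|].
  intros [|n] Hn; simpl; unfold sigma.
  - rewrite Nat.eqb_refl. reflexivity.
  - destruct (Nat.eqb_spec n k); [lia|reflexivity].
Qed.

Definition add_ax (T : theory) (f : form) : theory := fun g => T g \/ g = f.

Definition consistent (T : theory) : Prop := ~ proves T Bot.

Lemma proves_ax (T : theory) f : T f -> proves T f.
Proof.
  intros H. exists [f]. split; [intros g [<-|[]]; auto|apply prv_ctx; simpl; auto].
Qed.

Lemma proves_mono (T U : theory) f :
  (forall g, T g -> U g) -> proves T f -> proves U f.
Proof. intros H (A & HA & p). exists A; auto. Qed.

Lemma proves_impE T f g : proves T (Imp f g) -> proves T f -> proves T g.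
Proof.
  intros (A & HA & p) (B & HB & q). exists (A ++ B). split.
  - intros h Hh. apply in_app_or in Hh as []; auto.
  - apply prv_impE with f; eapply prv_weak; eauto using incl_appl, incl_appr, incl_refl.
Qed.

Lemma proves_impI T f g : proves (add_ax T f) g -> proves T (Imp f g).
Proof.
  intros (A & HA & p).
  assert (D : exists B, (forall h, In h B -> T h) /\ incl A (f :: B)).
  { clear p. induction A as [|a A IH].
    - exists []. split; [intros h []|intros h []].
    - destruct IH as (B & HB & HI); [intros; apply HA; simpl; auto|].
      destruct (HA a (or_introl eq_refl)) as [Ta| ->].
      + exists (a :: B). split; [intros h [<-|]; auto|].
        intros h [<-|Hh]; simpl; auto. destruct (HI h Hh); simpl; auto.
      + exists B. split; auto. apply incl_cons; simpl; auto. }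
  destruct D as (B & HB & HI). exists B. split; auto.
  apply prv_impI. eapply prv_weak; eauto.
Qed.

Lemma proves_prv_closed T f g :
  (forall A, prv A f -> prv A g) -> proves T f -> proves T g.
Proof. intros H (A & HA & p). exists A; auto. Qed.

Lemma proves_exfalso T f : proves T Bot -> proves T f.
Proof.
  apply proves_prv_closed. intros A p. apply prv_contra.
  eapply prv_weak; eauto. intros h; simpl; auto.
Qed.

Lemma proves_contra T f : proves (add_ax T (Not f)) Bot -> proves T f.
Proof.
  intros H. apply proves_impI in H. revert H. apply proves_prv_closed.
  intros A p. apply prv_contra. eapply prv_impE.
  - eapply prv_weak; [exact p|]. intros h; simpl; auto.
  - apply prv_ctx. simpl; auto.
Qed.

Lemma proves_not_Imp T f g : proves T (Not (Imp f g)) -> proves T f /\ proves T (Not g).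
Proof.
  intros H. split; apply proves_prv_closed with (2 := H); intros A p.
  - apply prv_contra. eapply prv_impE with (f := Imp f g).
    + eapply prv_weak; [exact p|]. intros h; simpl; auto.
    + apply prv_impI, prv_contra. apply prv_impE with f; apply prv_ctx; simpl; auto.
  - apply prv_impI. eapply prv_impE with (f := Imp f g).
    + eapply prv_weak; [exact p|]. intros h; simpl; auto.
    + apply prv_impI. apply prv_ctx; simpl; auto.
Qed.

(** ** Formulas are countable *)

Definition pair_code (m n : nat) : nat := to_nat (m, n).

Lemma pair_code_inj m n m' n' : pair_code m n = pair_code m' n' -> m = m' /\ n = n'.
Proof.
  unfold pair_code. intros H. apply to_nat_inj in H. inversion H. auto.
Qed.

(* Otherwise inversion tactics would unfold the arithmetic of the pairing. *)
Opaque pair_code.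

Fixpoint term_code (t : term) : nat :=
  match t with
  | var n => pair_code 0 n
  | zero => pair_code 1 0
  | one => pair_code 2 0
  | mone => pair_code 3 0
  | mul s u => pair_code 4 (pair_code (term_code s) (term_code u))
  | inv s => pair_code 5 (term_code s)
  end.

Fixpoint form_code (f : form) : nat :=
  match f with
  | Pos t => pair_code 0 (term_code t)
  | Eq s t => pair_code 1 (pair_code (term_code s) (term_code t))
  | Bot => pair_code 2 0
  | Imp g h => pair_code 3 (pair_code (form_code g) (form_code h))
  | All g => pair_code 4 (form_code g)
  end.

Ltac uncode :=
  repeat match goal with
  | H : pair_code _ _ = pair_code _ _ |- _ =>
      apply pair_code_inj in H as [? ?]; try discriminate
  end.

Lemma term_code_inj s : forall t, term_code s = term_code t -> s = t.
Proof.
  induction s; intros [] H; cbn [term_code form_code] in H; uncode; f_equal; auto.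
Qed.

Lemma form_code_inj f : forall g, form_code f = form_code g -> f = g.
Proof.
  induction f; intros [] H; cbn [term_code form_code] in H; uncode; f_equal; auto using term_code_inj.
Qed.

Definition form_enum (n : nat) : form :=
  epsilon (inhabits Bot) (fun f => form_code f = n).

Lemma form_enum_code f : form_enum (form_code f) = f.
Proof.
  apply form_code_inj. unfold form_enum.
  apply (epsilon_spec (inhabits Bot) (fun g => form_code g = form_code f)). eauto.
Qed.

(** ** Henkin witnesses and maximal consistent extensions *)

(** The witnesses are unused variables; these exist because the free variables
    of [T] are bounded, as they are for a set of sentences together with one
    formula. *)

Section Henkin.

Variable T : theory.
Variable k0 : nat.
Hypothesis T_bound : forall g, T g -> closed_at k0 g.
Hypothesis T_cons : consistent T.

(** [henkin_var n] bounds the free variables of [T], of the first [n]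
    Henkin axioms and of [form_enum n], so it can serve as a new constant. *)
Fixpoint henkin_var (n : nat) : nat :=
  max (form_bound (form_enum n))
      (match n with O => k0 | S m => S (henkin_var m) end).

Definition henkin_ax (n : nat) : form :=
  Imp (inst (form_enum n) (var (henkin_var n))) (All (form_enum n)).

Definition henkin_stage (n : nat) : theory :=
  fun g => T g \/ exists j, j < n /\ g = henkin_ax j.

Definition henkin_theory : theory := fun g => T g \/ exists j, g = henkin_ax j.

Lemma henkin_var_bound n : form_bound (form_enum n) <= henkin_var n.
Proof. destruct n; simpl; lia. Qed.

Lemma henkin_var_lt j n : j < n -> henkin_var j < henkin_var n.
Proof.
  induction n as [|n IH]; intros H; [lia|]. cbn [henkin_var].
  destruct (Nat.eq_dec j n) as [->|]; [|specialize (IH ltac:(lia))]; lia.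
Qed.

Lemma henkin_var_ge n : k0 <= henkin_var n.
Proof. induction n; simpl in *; lia. Qed.

Lemma henkin_ax_closed n : closed_at (S (henkin_var n)) (henkin_ax n).
Proof.
  pose proof (henkin_var_bound n). simpl. split.
  - eapply fsubst_closed_at; [apply form_bound_closed|].
    intros [|i] Hi; simpl; lia.
  - eapply closed_at_mono; [|apply form_bound_closed]; lia.
Qed.

Lemma henkin_stage_closed n g : henkin_stage n g -> closed_at (henkin_var n) g.
Proof.
  intros [H|(j & Hj & ->)].
  - eapply closed_at_mono; [apply henkin_var_ge|auto].
  - eapply closed_at_mono; [|apply henkin_ax_closed]. apply henkin_var_lt, Hj.
Qed.

(** If a Henkin axiom were refutable, its premise would be provable for a
    variable not occurring elsewhere, hence its conclusion as well. *)
Lemma henkin_stage_consistent n : consistent (henkin_stage n).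
Proof.
  induction n as [|n IH].
  - intros H. apply T_cons. revert H. apply proves_mono.
    intros g [Hg|(j & Hj & _)]; [auto|lia].
  - intros H. apply IH.
    assert (P : proves (henkin_stage n) (Not (henkin_ax n))).
    { apply proves_impI. revert H. apply proves_mono.
      intros g [Hg|(j & Hj & ->)]; [left; left; auto|].
      destruct (Nat.eq_dec j n) as [->|]; [right; auto|].
      left; right; exists j; split; auto; lia. }
    apply proves_not_Imp in P as [P1 P2]. eapply proves_impE; [exact P2|].
    destruct P1 as (A & HA & p). exists A. split; auto.
    eapply prv_generalize with (k := henkin_var n); [| |exact p].
    + intros g Hg. apply henkin_stage_closed; auto.
    + eapply closed_at_mono; [|apply form_bound_closed].
      pose proof (henkin_var_bound n). lia.
Qed.

Lemma henkin_theory_consistent : consistent henkin_theory.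
Proof.
  intros (A & HA & p).
  assert (D : exists n, forall g, In g A -> henkin_stage n g).
  { clear p. induction A as [|a A IH]; [exists 0; intros g []|].
    destruct IH as [n Hn]; [intros; apply HA; simpl; auto|].
    destruct (HA a (or_introl eq_refl)) as [Ta|[j ->]].
    - exists n. intros g [<-|Hg]; [left|]; auto.
    - exists (max n (S j)). intros g [<-|Hg].
      + right. exists j. split; [lia|auto].
      + destruct (Hn g Hg) as [|(i & Hi & ->)]; [left; auto|].
        right. exists i. split; [lia|auto]. }
  destruct D as [n Hn]. apply (henkin_stage_consistent n). exists A; auto.
Qed.

(** Lindenbaum's construction of a maximal consistent extension. *)
Fixpoint lind_stage (n : nat) : theory :=
  match n with
  | O => henkin_theory
  | S m => fun g => lind_stage m g \/
             (g = form_enum m /\ consistent (add_ax (lind_stage m) (form_enum m)))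
  end.

Definition lind : theory := fun g => exists n, lind_stage n g.

Lemma lind_stage_mono n m g : n <= m -> lind_stage n g -> lind_stage m g.
Proof. induction 1; simpl; auto. Qed.

Lemma lind_stage_consistent n : consistent (lind_stage n).
Proof.
  induction n as [|n IH]; [apply henkin_theory_consistent|]. intros H.
  destruct (classic (consistent (add_ax (lind_stage n) (form_enum n)))) as [C|C].
  - apply C. revert H. apply proves_mono. intros g [Hg|[-> _]]; [left|right]; auto.
  - apply IH. revert H. apply proves_mono. intros g [Hg|[_ Hg]]; tauto.
Qed.

Lemma lind_consistent : consistent lind.
Proof.
  intros (A & HA & p).
  assert (D : exists n, forall g, In g A -> lind_stage n g).
  { clear p. induction A as [|a A IH]; [exists 0; intros g []|].
    destruct IH as [n Hn]; [intros; apply HA; simpl; auto|].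
    destruct (HA a (or_introl eq_refl)) as [j Hj].
    exists (max n j). intros g [<-|Hg];
      [apply lind_stage_mono with j|apply lind_stage_mono with n]; auto; lia. }
  destruct D as [n Hn]. apply (lind_stage_consistent n). exists A; auto.
Qed.

Lemma lind_maximal f : consistent (add_ax lind f) -> lind f.
Proof.
  intros C. exists (S (form_code f)). right. rewrite form_enum_code. split; auto.
  intros H. apply C. revert H. apply proves_mono.
  intros g [Hg| ->]; [left; exists (form_code f); auto|right; auto].
Qed.

Lemma lind_closed f : proves lind f -> lind f.
Proof.
  intros H. apply lind_maximal. intros C. apply lind_consistent.
  apply proves_impI in C. eapply proves_impE; eauto.
Qed.

Lemma lind_Bot : ~ lind Bot.
Proof. intros H. apply lind_consistent, proves_ax, H. Qed.

Lemma lind_Imp f g : lind (Imp f g) <-> (lind f -> lind g).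
Proof.
  split.
  - intros H Hf. apply lind_closed. eapply proves_impE; apply proves_ax; eauto.
  - intros H. destruct (classic (lind f)) as [Hf|Hf].
    + apply lind_closed, proves_impI, proves_ax. left. auto.
    + apply lind_closed, proves_impI, proves_exfalso.
      apply NNPP. intros N. apply Hf, lind_maximal, N.
Qed.

(** The Henkin axiom for [f] makes its witness decide [All f]. *)
Lemma lind_All f : lind (All f) <-> forall t, lind (inst f t).
Proof.
  split.
  - intros H t. apply lind_closed.
    apply proves_prv_closed with (f := All f); [|apply proves_ax, H].
    intros A. apply prv_allE.
  - intros H.
    assert (Hx : lind (henkin_ax (form_code f))) by (exists 0; right; eauto).
    unfold henkin_ax in Hx. rewrite form_enum_code in Hx.
    apply (proj1 (lind_Imp _ _) Hx). apply H.
Qed.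

Lemma lind_eq_refl t : lind (Eq t t).
Proof. apply lind_closed. exists []. split; [intros g []|apply prv_eqI]. Qed.

(** Congruence of provable equality reduces to this rule, applied to formulas
    in which all terms but the one to be replaced are shifted. *)
Lemma lind_eqE f s t : lind (Eq s t) -> lind (inst f s) -> lind (inst f t).
Proof.
  intros H1 H2. apply lind_closed.
  apply proves_ax in H1, H2. destruct H1 as (A & HA & p), H2 as (B & HB & q).
  exists (A ++ B). split.
  - intros h Hh. apply in_app_or in Hh as []; auto.
  - apply prv_eqE with s; eapply prv_weak; eauto using incl_appl, incl_appr, incl_refl.
Qed.

Lemma tsubst_shift_inst s t : tsubst (scons t var) (tsubst shift s) = s.
Proof. rewrite tsubst_comp. apply tsubst_id. Qed.

Lemma lind_eq_sym s t : lind (Eq s t) -> lind (Eq t s).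
Proof.
  intros H. pose proof (lind_eqE (Eq (var 0) (tsubst shift s)) s t H) as E.
  unfold inst in E; simpl in E. rewrite !tsubst_shift_inst in E.
  apply E, lind_eq_refl.
Qed.

Lemma lind_eq_trans s t u : lind (Eq s t) -> lind (Eq t u) -> lind (Eq s u).
Proof.
  intros H1 H2. pose proof (lind_eqE (Eq (tsubst shift s) (var 0)) t u H2) as E.
  unfold inst in E; simpl in E. rewrite !tsubst_shift_inst in E. auto.
Qed.

Lemma lind_eq_inv s t : lind (Eq s t) -> lind (Eq (inv s) (inv t)).
Proof.
  intros H.
  pose proof (lind_eqE (Eq (tsubst shift (inv s)) (inv (var 0))) s t H) as E.
  unfold inst in E; simpl in E. rewrite !tsubst_shift_inst in E.
  apply E, lind_eq_refl.
Qed.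

Lemma lind_eq_mul s t s' t' :
  lind (Eq s t) -> lind (Eq s' t') -> lind (Eq (mul s s') (mul t t')).
Proof.
  intros H H'. apply lind_eq_trans with (mul s t').
  - pose proof (lind_eqE (Eq (tsubst shift (mul s s')) (mul (tsubst shift s) (var 0)))
      s' t' H') as E.
    unfold inst in E; simpl in E. rewrite !tsubst_shift_inst in E.
    apply E, lind_eq_refl.
  - pose proof (lind_eqE (Eq (tsubst shift (mul s t')) (mul (var 0) (tsubst shift t')))
      s t H) as E.
    unfold inst in E; simpl in E. rewrite !tsubst_shift_inst in E.
    apply E, lind_eq_refl.
Qed.

Lemma lind_eq_Pos s t : lind (Eq s t) -> lind (Pos s) -> lind (Pos t).
Proof. apply (lind_eqE (Pos (var 0))). Qed.

(** ** The term model *)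

(** Equality must be interpreted by identity, so the elements are the classes
    of provably equal terms. *)

Definition cls (t : term) : term -> Prop := fun s => lind (Eq t s).

Definition term_class : Type := { c : term -> Prop | exists t, c = cls t }.

Definition to_class (t : term) : term_class := exist _ (cls t) (ex_intro _ t eq_refl).

Definition repr (c : term_class) : term :=
  proj1_sig (constructive_indefinite_description _ (proj2_sig c)).

Lemma to_class_eq s t : to_class s = to_class t <-> lind (Eq s t).
Proof.
  split.
  - intros H. assert (E : cls s t = cls t t).
    { change (proj1_sig (to_class s) t = proj1_sig (to_class t) t).
      rewrite H. reflexivity. }
    change (cls s t). rewrite E. apply lind_eq_refl.
  - intros H. apply subset_eq_compat, functional_extensionality. intros u.
    apply propositional_extensionality. unfold cls.
    split; intros; eauto using lind_eq_sym, lind_eq_trans.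
Qed.

Lemma to_class_repr c : to_class (repr c) = c.
Proof.
  destruct c as [c Hc]. apply subset_eq_compat. unfold repr; simpl.
  symmetry. apply (proj2_sig (constructive_indefinite_description _ Hc)).
Qed.

Lemma repr_to_class t : lind (Eq (repr (to_class t)) t).
Proof. apply to_class_eq, to_class_repr. Qed.

Definition term_model : structure :=
  Structure term_class (to_class zero) (to_class one) (to_class mone)
    (fun c d => to_class (mul (repr c) (repr d)))
    (fun c => to_class (inv (repr c)))
    (fun c => lind (Pos (repr c))).

Lemma eval_term_model sigma t :
  eval term_model (fun n => to_class (sigma n)) t = to_class (tsubst sigma t).
Proof.
  induction t; simpl; auto.
  - rewrite IHt1, IHt2. apply to_class_eq, lind_eq_mul; apply repr_to_class.
  - rewrite IHt. apply to_class_eq, lind_eq_inv, repr_to_class.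
Qed.

(** Assignments in the term model are substitutions, so the induction has to
    range over all of these. *)
Lemma truth_lemma f : forall sigma,
  sat term_model (fun n => to_class (sigma n)) f <-> lind (fsubst sigma f).
Proof.
  induction f; intros sigma; simpl.
  - rewrite eval_term_model.
    split; apply lind_eq_Pos; auto using lind_eq_sym, repr_to_class.
  - rewrite !eval_term_model. apply to_class_eq.
  - split; [tauto|apply lind_Bot].
  - rewrite IHf1, IHf2, lind_Imp. tauto.
  - rewrite lind_All.
    assert (E : forall t, sat term_model
        (econs term_model (to_class t) (fun n => to_class (sigma n))) f
        <-> lind (inst (fsubst (up sigma) f) t)).
    { intros t. rewrite inst_fsubst_up, <- IHf. apply sat_ext.
      intros [|n]; reflexivity. }
    split.
    + intros H t. apply E, H.
    + intros H c. rewrite <- (to_class_repr c). apply E, H.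
Qed.

Lemma model_existence : exists (M : structure) rho, forall g, T g -> sat M rho g.
Proof.
  exists term_model, (fun n => to_class (var n)). intros g Hg.
  apply truth_lemma. rewrite fsubst_id. exists 0. left. exact Hg.
Qed.

End Henkin.

(** An unprovable [f] has a model of [T] and [Not f], in which the free
    variables of [f] are interpreted by themselves. *)
Theorem completeness (T : theory) f :
  (forall g, T g -> sentence g) ->
  (forall M : structure, (forall g, T g -> models M g) -> models M f) ->
  proves T f.
Proof.
  intros HT H. apply proves_contra, NNPP. intros C.
  destruct (model_existence (add_ax T (Not f)) (form_bound f)) as (M & rho & HM).
  - intros g [Hg| ->].
    + eapply closed_at_mono; [|apply HT, Hg]. lia.
    + simpl. split; auto using form_bound_closed.
  - exact C.
  - apply (HM (Not f)); [right; reflexivity|]. apply H.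
    intros g Hg. apply sat_sentence with rho; [|apply HM; left]; auto.
Qed.

(** * Integer relations in torsion-free abelian groups *)

Local Open Scope Z_scope.

Record zmodule : Type := ZModule {
  zcarrier :> Type;
  zzero : zcarrier;
  zadd : zcarrier -> zcarrier -> zcarrier;
  zsmul : Z -> zcarrier -> zcarrier;
  zadd_comm : forall x y, zadd x y = zadd y x;
  zadd_assoc : forall x y z, zadd x (zadd y z) = zadd (zadd x y) z;
  zadd_0_l : forall x, zadd zzero x = x;
  zsmul_0_l : forall x, zsmul 0 x = zzero;
  zsmul_1_l : forall x, zsmul 1 x = x;
  zsmul_add_l : forall a b x, zsmul (a + b) x = zadd (zsmul a x) (zsmul b x);
  zsmul_add_r : forall a x y, zsmul a (zadd x y) = zadd (zsmul a x) (zsmul a y);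
  zsmul_mul : forall a b x, zsmul (a * b) x = zsmul a (zsmul b x)
}.

Arguments zzero {_}.
Arguments zadd {_} _ _.
Arguments zsmul {_} _ _.

Definition torsion_free (V : zmodule) : Prop :=
  forall k (x : V), k <> 0 -> zsmul k x = zzero -> x = zzero.

Definition divisible (V : zmodule) : Prop :=
  forall k (x : V), k <> 0 -> exists y, zsmul k y = x.

Definition nontrivial (V : zmodule) : Prop := exists x : V, x <> zzero.

Section ModuleFacts.
Context {V : zmodule}.
Implicit Types x y z : V.

Lemma zadd_0_r x : zadd x zzero = x.
Proof. rewrite zadd_comm. apply zadd_0_l. Qed.

Lemma zsmul_0_r a : zsmul a (zzero : V) = zzero.
Proof.
  rewrite <- (zsmul_0_l V zzero), <- zsmul_mul, Z.mul_0_r. reflexivity.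
Qed.

Lemma zadd_opp_r x : zadd x (zsmul (-1) x) = zzero.
Proof.
  rewrite <- (zsmul_1_l V x) at 1. rewrite <- zsmul_add_l. apply zsmul_0_l.
Qed.

Lemma zadd_swap x y z t : zadd (zadd x y) (zadd z t) = zadd (zadd x z) (zadd y t).
Proof.
  rewrite !zadd_assoc. f_equal. rewrite <- !zadd_assoc. f_equal. apply zadd_comm.
Qed.

Lemma zadd_opp_eq x y : zadd x (zsmul (-1) y) = zzero <-> x = y.
Proof.
  split; [|intros ->; apply zadd_opp_r]. intros H.
  rewrite <- (zadd_0_r x), <- (zadd_opp_r y), (zadd_comm _ y), zadd_assoc, H.
  apply zadd_0_l.
Qed.

Fixpoint dot (m : nat) (e : nat -> Z) (u : nat -> V) : V :=
  match m with
  | O => zzero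
  | S n => zadd (zsmul (e 0%nat) (u 0%nat))
                (dot n (fun i => e (S i)) (fun i => u (S i)))
  end.

Lemma dot_ext m : forall e e' u u',
  (forall i, (i < m)%nat -> e i = e' i) -> (forall i, (i < m)%nat -> u i = u' i) ->
  dot m e u = dot m e' u'.
Proof.
  induction m as [|m IH]; intros e e' u u' He Hu; simpl; auto.
  rewrite (He 0%nat), (Hu 0%nat) by lia. f_equal.
  apply IH; intros; [apply He|apply Hu]; lia.
Qed.

Lemma dot_0_l m : forall u, dot m (fun _ => 0) u = zzero.
Proof.
  induction m; intros; simpl; auto. rewrite IHm, zsmul_0_l. apply zadd_0_l.
Qed.

Lemma dot_add m : forall e e' u,
  dot m (fun i => e i + e' i) u = zadd (dot m e u) (dot m e' u).
Proof.
  induction m as [|m IH]; intros; simpl; [symmetry; apply zadd_0_l|].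
  rewrite zsmul_add_l, (IH (fun i => e (S i)) (fun i => e' (S i))). apply zadd_swap.
Qed.

Lemma dot_scale m : forall k e u, dot m (fun i => k * e i) u = zsmul k (dot m e u).
Proof.
  induction m as [|m IH]; intros; simpl; [symmetry; apply zsmul_0_r|].
  rewrite (IH k (fun i => e (S i))), zsmul_add_r, zsmul_mul. reflexivity.
Qed.

Lemma dot_smul m : forall k e u, dot m e (fun i => zsmul k (u i)) = zsmul k (dot m e u).
Proof.
  induction m as [|m IH]; intros; simpl; [symmetry; apply zsmul_0_r|].
  rewrite (IH k _ (fun i => u (S i))), zsmul_add_r, <- !zsmul_mul, Z.mul_comm. reflexivity.
Qed.

Lemma dot_delta m : forall n u, (n < m)%nat ->
  dot m (fun i => if Nat.eqb n i then 1 else 0) u = u n.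
Proof.
  induction m as [|m IH]; intros n u Hn; [lia|]. simpl. destruct n as [|n]; simpl.
  - rewrite dot_0_l, zsmul_1_l. apply zadd_0_r.
  - rewrite zsmul_0_l, zadd_0_l. apply (IH n (fun i => u (S i))). lia.
Qed.

Lemma dot_sub m e e' u :
  dot m (fun i => e i - e' i) u = zzero <-> dot m e u = dot m e' u.
Proof.
  rewrite <- (zadd_opp_eq (dot m e u)), <- dot_scale, <- dot_add.
  rewrite (dot_ext m (fun i => e i - e' i) (fun i => e i + -1 * e' i) u u);
    [reflexivity|intros; lia|auto].
Qed.

(** Eliminate [x] from a relation by means of another relation [e0], [k0]
    that contains it. *)
Lemma relation_elim m k0 e0 k e (u : nat -> V) x :
  torsion_free V -> k0 <> 0 -> zadd (zsmul k0 x) (dot m e0 u) = zzero ->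
  zadd (zsmul k x) (dot m e u) = zzero <->
  dot m (fun i => k0 * e i - k * e0 i) u = zzero.
Proof.
  intros Htf Hk0 H0.
  assert (E : dot m (fun i => k0 * e i - k * e0 i) u =
              zsmul k0 (zadd (zsmul k x) (dot m e u))).
  { rewrite <- (zadd_0_r (zsmul k0 _)), <- (zsmul_0_r (- k)), <- H0.
    rewrite !zsmul_add_r, <- !zsmul_mul, zadd_swap, <- zsmul_add_l.
    replace (k0 * k + - k * k0) with 0 by ring.
    rewrite zsmul_0_l, zadd_0_l, <- !dot_scale, <- dot_add.
    apply dot_ext; auto; intros; ring. }
  rewrite E. split; [intros ->; apply zsmul_0_r|apply Htf; auto].
Qed.

End ModuleFacts.

Definition bounded (m : nat) (N : Z) (e : nat -> Z) : Prop :=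
  forall i, (i < m)%nat -> Z.abs (e i) <= N.

(** The same relations hold in [u] and in [w].  Bounding the coefficients makes
    this a finite amount of information, which a formula can express. *)
Definition related {V W : zmodule} (m : nat) (N : Z) (u : nat -> V) (w : nat -> W) : Prop :=
  forall e, bounded m N e -> dot m e u = zzero <-> dot m e w = zzero.

Definition vcons {A : Type} (a : A) (u : nat -> A) (n : nat) : A :=
  match n with O => a | S k => u k end.

Lemma abs_mul_le a b N : Z.abs a <= N -> Z.abs b <= N -> Z.abs (a * b) <= N * N.
Proof. rewrite Z.abs_mul. nia. Qed.

(** If [x] satisfies a relation over [u] with small coefficients, then a
    solution [y] of that relation over [w] will do: all other relations of
    [x] reduce, by elimination, to relations over [u] whose coefficients are
    at most [2 * N * N].  Otherwise any [y] without small relations will do. *)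
Lemma related_extend (V W : zmodule) m N (u : nat -> V) (w : nat -> W) (C : W -> Prop) :
  torsion_free V -> torsion_free W -> related m (2 * N * N) u w ->
  (forall e k, bounded m N e -> k <> 0 -> Z.abs k <= N ->
     exists y, C y /\ zadd (zsmul k y) (dot m e w) = zzero) ->
  (exists y, C y /\ forall e k, bounded m N e -> k <> 0 -> Z.abs k <= N ->
     zadd (zsmul k y) (dot m e w) <> zzero) ->
  forall x, exists y, C y /\ related (S m) N (vcons x u) (vcons y w).
Proof.
  intros HV HW Huw Hsolve Hfresh x.
  assert (tail : forall e, bounded (S m) N e -> bounded m N (fun i => e (S i))).
  { intros e He i Hi. apply He. lia. }
  destruct (classic (exists e k, bounded m N e /\ k <> 0 /\ Z.abs k <= N /\
                     zadd (zsmul k x) (dot m e u) = zzero))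
    as [(e0 & k0 & He0 & Hk0 & HN & H0)|no].
  - destruct (Hsolve e0 k0 He0 Hk0 HN) as (y & Cy & Hy). exists y. split; auto.
    intros e He. simpl. pose proof (tail e He) as Ht.
    assert (H1 : Z.abs (e 0%nat) <= N) by (apply He; lia).
    rewrite (relation_elim m k0 e0 (e 0%nat) (fun i => e (S i)) u x),
            (relation_elim m k0 e0 (e 0%nat) (fun i => e (S i)) w y) by auto.
    apply Huw. intros i Hi.
    pose proof (abs_mul_le k0 _ N HN (Ht i Hi)).
    pose proof (abs_mul_le (e 0%nat) _ N H1 (He0 i Hi)). cbv beta in *. lia.
  - destruct Hfresh as (y & Cy & Hy). exists y. split; auto.
    intros e He. simpl. pose proof (tail e He) as Ht.
    assert (H1 : Z.abs (e 0%nat) <= N) by (apply He; lia).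
    destruct (Z.eq_dec (e 0%nat) 0) as [E|E].
    + rewrite E, !zsmul_0_l, !zadd_0_l. apply Huw.
      intros i Hi. specialize (Ht i Hi). cbv beta in *. nia.
    + split; intros H; exfalso.
      * apply no. exists (fun i => e (S i)), (e 0%nat). auto.
      * eapply Hy; eauto.
Qed.

(** ** Coefficient vectors up to a bound form a finite set *)

Definition zrange (N : nat) : list Z :=
  map (fun i => Z.of_nat i - Z.of_nat N) (seq 0 (2 * N + 1)).

Lemma in_zrange N k : Z.abs k <= Z.of_nat N -> In k (zrange N).
Proof.
  intros H. unfold zrange. apply in_map_iff. exists (Z.to_nat (k + Z.of_nat N)).
  split; [lia|]. apply in_seq. lia.
Qed.

Fixpoint box (m N : nat) : list (nat -> Z) :=
  match m with
  | O => [fun _ => 0]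
  | S n => flat_map (fun k => map (vcons k) (box n N)) (zrange N)
  end.

Lemma box_complete m N : forall e, bounded m (Z.of_nat N) e ->
  exists e', In e' (box m N) /\ forall i, (i < m)%nat -> e i = e' i.
Proof.
  induction m as [|m IH]; intros e He.
  - exists (fun _ => 0). split; [simpl; auto|lia].
  - destruct (IH (fun i => e (S i))) as (e' & He' & Hee').
    { intros i Hi. apply He. lia. }
    exists (vcons (e 0%nat) e'). split.
    + simpl. apply in_flat_map. exists (e 0%nat). split.
      * apply in_zrange, He. lia.
      * apply in_map, He'.
    + intros [|i] Hi; simpl; auto. apply Hee'. lia.
Qed.

Lemma eventually_avoid {A : Type} (L : list A) (P : A -> Z -> Prop) :
  (forall a i j, P a i -> P a j -> i = j) ->
  exists n, forall a, In a L -> ~ P a n.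
Proof.
  intros H. enough (D : exists n, forall k a, n <= k -> In a L -> ~ P a k).
  { destruct D as [n Hn]. exists n. intros a. apply Hn. lia. }
  induction L as [|a L (n & IH)]; [exists 0; intros k a _ []|].
  destruct (classic (exists i, P a i)) as [[i Hi]|N].
  - exists (Z.max n (i + 1)). intros k b Hk [<-|Hb] HP.
    + specialize (H _ _ _ Hi HP). lia.
    + apply (IH k b); auto; lia.
  - exists n. intros k b Hk [<-|Hb] HP; [eauto|]. apply (IH k b); auto.
Qed.

(** The multiples of a nonzero element are pairwise distinct, while each of
    the finitely many relations excludes at most one of them. *)
Lemma exists_unrelated (W : zmodule) m N (w : nat -> W) :
  torsion_free W -> nontrivial W ->
  exists y, forall e k, bounded m (Z.of_nat N) e -> k <> 0 -> Z.abs k <= Z.of_nat N ->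
    zadd (zsmul k y) (dot m e w) <> zzero.
Proof.
  intros Htf [x Hx].
  destruct (eventually_avoid (box (S m) N)
    (fun e j => e 0%nat <> 0 /\ dot (S m) e (vcons (zsmul j x) w) = zzero)) as [n Hn].
  - simpl. intros e i j [He Hi] [_ Hj].
    destruct (Z.eq_dec i j) as [|D]; auto. exfalso.
    assert (E : zsmul (e 0%nat) (zsmul i x) = zsmul (e 0%nat) (zsmul j x)).
    { set (d := dot m _ _) in *.
      assert (Q : zadd (zsmul (e 0%nat) (zsmul i x)) d =
                  zadd (zsmul (e 0%nat) (zsmul j x)) d) by congruence.
      apply (f_equal (fun z => zadd z (zsmul (-1) d))) in Q.
      rewrite <- !zadd_assoc, zadd_opp_r, !zadd_0_r in Q. exact Q. }
    apply zadd_opp_eq in E. rewrite <- !zsmul_mul, <- zsmul_add_l in E.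
    apply Hx. refine (Htf _ _ _ E). nia.
  - exists (zsmul n x). intros e k He Hk HkN E.
    destruct (box_complete (S m) N (vcons k e)) as (e' & He' & Hee').
    { intros [|i] Hi; simpl; auto. apply He. lia. }
    apply (Hn e' He'). split.
    + rewrite <- Hee' by lia. simpl. auto.
    + rewrite <- (dot_ext (S m) (vcons k e) e' (vcons (zsmul n x) w)
                    (vcons (zsmul n x) w)); auto.
Qed.

(** In a divisible group all relations are solvable. *)
Lemma related_extend_divisible (V W : zmodule) m N (u : nat -> V) (w : nat -> W) x :
  torsion_free V -> torsion_free W -> divisible W -> nontrivial W ->
  related m (2 * Z.of_nat N * Z.of_nat N) u w ->
  exists y, related (S m) (Z.of_nat N) (vcons x u) (vcons y w).
Proof.
  intros HV HW HD HN H.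
  destruct (related_extend V W m (Z.of_nat N) u w (fun _ => True)) with (x := x)
    as (y & _ & Hy); auto.
  - intros e k _ Hk _. destruct (HD k (zsmul (-1) (dot m e w)) Hk) as [y Hy].
    exists y. split; auto. rewrite Hy, zadd_comm. apply zadd_opp_r.
  - destruct (exists_unrelated W m N w HW HN) as [y Hy]. exists y. auto.
  - exists y. exact Hy.
Qed.

(** ** Signed elements *)

(** The structure [signed V] has a zero and, for each sign, a copy of [V].
    For [V = (R, +)] this is the multiplicative structure of the reals, written
    logarithmically. *)

Definition selem (V : zmodule) : Type := option (bool * V).

Definition shape {V : zmodule} (a : selem V) : option bool := option_map fst a.

Definition vec {V : zmodule} (a : selem V) : V :=
  match a with None => zzero | Some (_, x) => x end.

Definition smul_elem {V : zmodule} (a b : selem V) : selem V :=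
  match a, b with
  | Some (s, x), Some (t, y) => Some (Bool.eqb s t, zadd x y)
  | _, _ => None
  end.

Definition sinv_elem {V : zmodule} (a : selem V) : selem V :=
  option_map (fun p => (fst p, zsmul (-1) (snd p))) a.

Definition signed (V : zmodule) : structure :=
  Structure (selem V) None (Some (true, zzero)) (Some (false, zzero))
    smul_elem sinv_elem (fun a => shape a = Some true).

Lemma selem_eq {V : zmodule} (a b : selem V) :
  a = b <-> shape a = shape b /\ vec a = vec b.
Proof.
  split; [intros ->; auto|].
  destruct a as [[s x]|], b as [[t y]|]; simpl; intros [H1 H2]; congruence.
Qed.

Fixpoint coef (t : term) (i : nat) : Z :=
  match t with
  | var n => if Nat.eqb n i then 1 else 0
  | zero | one | mone => 0
  | mul s u => coef s i + coef u i
  | inv s => - coef s i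
  end.

Fixpoint tsize (t : term) : nat :=
  match t with
  | var _ => 1
  | zero | one | mone => 0
  | mul s u => tsize s + tsize u
  | inv s => tsize s
  end%nat.

Lemma coef_bound t i : Z.abs (coef t i) <= Z.of_nat (tsize t).
Proof. induction t; simpl; try destruct (Nat.eqb n i); lia. Qed.

Lemma shape_eval_eq {V W : zmodule} m (rho : nat -> selem V) (tau : nat -> selem W) t :
  (forall i, (i < m)%nat -> shape (rho i) = shape (tau i)) -> term_closed_at m t ->
  shape (eval (signed V) rho t) = shape (eval (signed W) tau t).
Proof.
  intros H. induction t; simpl; auto.
  - intros [H1 H2]. specialize (IHt1 H1). specialize (IHt2 H2).
    destruct (eval (signed V) rho t1) as [[]|], (eval (signed V) rho t2) as [[]|],
      (eval (signed W) tau t1) as [[]|], (eval (signed W) tau t2) as [[]|]; simpl in *; congruence.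
  - intros H1. specialize (IHt H1).
    destruct (eval (signed V) rho t) as [[]|], (eval (signed W) tau t) as [[]|]; simpl in *; congruence.
Qed.

Lemma vec_eval {V : zmodule} m (rho : nat -> selem V) t :
  term_closed_at m t -> eval (signed V) rho t <> None ->
  vec (eval (signed V) rho t) = dot m (coef t) (fun i => vec (rho i)).
Proof.
  induction t; intros Ht Hn.
  - cbn [coef eval]. symmetry. apply (dot_delta m n (fun i => vec (rho i)) Ht).
  - simpl in Hn. congruence.
  - symmetry. apply dot_0_l.
  - symmetry. apply dot_0_l.
  - simpl in Ht. cbn [coef]. rewrite dot_add, <- IHt1, <- IHt2; try tauto;
      simpl in *; destruct (eval (signed V) rho t1) as [[]|], (eval (signed V) rho t2) as [[]|];
      simpl in *; congruence.
  - cbn [coef].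
    rewrite (dot_ext m _ (fun i => -1 * coef t i) _ (fun i => vec (rho i)))
      by (intros; auto; lia).
    rewrite dot_scale, <- IHt; auto;
      simpl in *; destruct (eval (signed V) rho t) as [[]|]; simpl in *; congruence.
Qed.

Lemma eval_eq_iff {V : zmodule} m (rho : nat -> selem V) s t :
  term_closed_at m s -> term_closed_at m t ->
  eval (signed V) rho s = eval (signed V) rho t <->
  shape (eval (signed V) rho s) = shape (eval (signed V) rho t) /\
  (shape (eval (signed V) rho s) = None \/
   dot m (fun i => coef s i - coef t i) (fun i => vec (rho i)) = zzero).
Proof.
  intros Hs Ht. rewrite dot_sub. etransitivity; [apply (@selem_eq V)|].
  pose proof (vec_eval m rho s Hs) as Es. pose proof (vec_eval m rho t Ht) as Et.
  destruct (eval (signed V) rho s) as [[a x]|], (eval (signed V) rho t) as [[b y]|]; simpl in *;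
    intuition congruence.
Qed.

(** ** Agreement of assignments *)

Definition agree {V W : zmodule} (m : nat) (N : Z)
    (rho : nat -> selem V) (tau : nat -> selem W) : Prop :=
  (forall i, (i < m)%nat -> shape (rho i) = shape (tau i)) /\
  related m N (fun i => vec (rho i)) (fun i => vec (tau i)).

Lemma agree_mono {V W : zmodule} m N N' (rho : nat -> selem V) (tau : nat -> selem W) :
  N' <= N -> agree m N rho tau -> agree m N' rho tau.
Proof.
  intros HN [H1 H2]. split; auto. intros e He. apply H2.
  intros i Hi. specialize (He i Hi). lia.
Qed.

Lemma agree_sym {V W : zmodule} m N (rho : nat -> selem V) (tau : nat -> selem W) :
  agree m N rho tau -> agree m N tau rho.
Proof.
  intros [H1 H2]. split; [intros; symmetry; auto|].
  intros e He. symmetry. apply H2, He.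
Qed.

Lemma agree_trans {U V W : zmodule} m N (rho : nat -> selem U)
    (tau : nat -> selem V) (ups : nat -> selem W) :
  agree m N rho tau -> agree m N tau ups -> agree m N rho ups.
Proof.
  intros [H1 H2] [H3 H4]. split; [intros; rewrite H1, H3; auto|].
  intros e He. rewrite (H2 e He). apply H4, He.
Qed.

Lemma agree_ext {V W : zmodule} m N (rho : nat -> selem V) (tau tau' : nat -> selem W) :
  (forall i, (i < m)%nat -> tau i = tau' i) -> agree m N rho tau -> agree m N rho tau'.
Proof.
  intros E [H1 H2]. split.
  - intros i Hi. rewrite <- E by auto. auto.
  - intros e He. rewrite (H2 e He).
    erewrite (dot_ext m e e); [reflexivity|auto|]. intros i Hi. simpl. rewrite E; auto.
Qed.

Lemma agree_cons {V W : zmodule} m N (rho : nat -> selem V) (tau : nat -> selem W) a b :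
  agree m N rho tau -> shape a = shape b ->
  related (S m) N (vcons (vec a) (fun i => vec (rho i)))
                  (vcons (vec b) (fun i => vec (tau i))) ->
  agree (S m) N (vcons a rho) (vcons b tau).
Proof.
  intros [H1 H2] Hab H. split.
  - intros [|i] Hi; simpl; auto. apply H1. lia.
  - exact H.
Qed.

Lemma agree_cons_None {V W : zmodule} m N (rho : nat -> selem V) (tau : nat -> selem W) :
  agree m N rho tau -> agree (S m) N (vcons None rho) (vcons None tau).
Proof.
  intros H. apply agree_cons; auto. intros e He. simpl.
  rewrite !zsmul_0_r, !zadd_0_l. apply H. intros i Hi. apply He. lia.
Qed.

Lemma agree_Pos {V W : zmodule} m N (rho : nat -> selem V) (tau : nat -> selem W) t :
  agree m N rho tau -> term_closed_at m t ->
  sat (signed V) rho (Pos t) <-> sat (signed W) tau (Pos t).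
Proof.
  intros [H _] Ht. simpl. rewrite (shape_eval_eq m rho tau t H Ht). reflexivity.
Qed.

Lemma agree_Eq {V W : zmodule} m (rho : nat -> selem V) (tau : nat -> selem W) s t :
  agree m (Z.of_nat (tsize s + tsize t)) rho tau ->
  term_closed_at m s -> term_closed_at m t ->
  sat (signed V) rho (Eq s t) <-> sat (signed W) tau (Eq s t).
Proof.
  intros [H H'] Hs Ht.
  etransitivity; [apply (eval_eq_iff m rho s t Hs Ht)|].
  etransitivity; [|symmetry; apply (eval_eq_iff m tau s t Hs Ht)].
  rewrite (shape_eval_eq m rho tau s H Hs), (shape_eval_eq m rho tau t H Ht).
  rewrite (H' (fun i => coef s i - coef t i)); [reflexivity|].
  intros i _. pose proof (coef_bound s i). pose proof (coef_bound t i). lia.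
Qed.

(** * A finite evaluation procedure *)

Definition Zmod : zmodule.
Proof.
  refine (ZModule Z 0 Z.add Z.mul _ _ _ _ _ _ _ _); intros; ring.
Defined.

Lemma Zmod_torsion_free : torsion_free Zmod.
Proof. intros k x Hk H. simpl in *. nia. Qed.

Local Open Scope nat_scope.

(** [Vnz s p n] stands for the element of sign [s] and exponent [p - n]; keeping
    the two parts separate avoids subtraction. *)
Inductive val : Type :=
| Vzero : val
| Vnz : bool -> nat -> nat -> val.

Definition val_elem (v : val) : selem Zmod :=
  match v with
  | Vzero => None
  | Vnz s p n => Some (s, (Z.of_nat p - Z.of_nat n)%Z)
  end.

Definition vmul (v w : val) : val :=
  match v with
  | Vzero => Vzero
  | Vnz s p n =>
      match w with
      | Vzero => Vzero
      | Vnz s' p' n' => Vnz (Bool.eqb s s') (p + p') (n + n')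
      end
  end.

Definition vinv (v : val) : val :=
  match v with Vzero => Vzero | Vnz s p n => Vnz s n p end.

Definition veqb (v w : val) : bool :=
  match v with
  | Vzero => match w with Vzero => true | Vnz _ _ _ => false end
  | Vnz s p n =>
      match w with
      | Vzero => false
      | Vnz s' p' n' => andb (Bool.eqb s s') (Nat.eqb (p + n') (p' + n))
      end
  end.

Definition vpos (v : val) : bool :=
  match v with Vzero => false | Vnz s _ _ => s end.

Definition vscale (k : nat) (v : val) : val :=
  match v with Vzero => Vzero | Vnz s p n => Vnz s (k * p) (k * n) end.

Definition vsize (v : val) : nat :=
  match v with Vzero => 0 | Vnz _ p n => p + n end.

Fixpoint env_get (n : nat) (env : list val) : val :=
  match n with
  | O => match env with [] => Vzero | v :: _ => v end
  | S k => match env with [] => Vzero | _ :: l => env_get k l end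
  end.

Fixpoint env_scale (k : nat) (env : list val) : list val :=
  match env with [] => [] | v :: l => vscale k v :: env_scale k l end.

Fixpoint env_size (env : list val) : nat :=
  match env with [] => 0 | v :: l => vsize v + env_size l end.

Fixpoint tev (t : term) (env : list val) : val :=
  match t with
  | var n => env_get n env
  | zero => Vzero
  | one => Vnz true 0 0
  | mone => Vnz false 0 0
  | mul s u => vmul (tev s env) (tev u env)
  | inv s => vinv (tev s env)
  end.

(** The coefficient bound up to which assignments must agree in order to give
    [f] the same truth value.  At a quantifier it grows quadratically, as in
    [related_extend]. *)
Fixpoint rank (f : form) : nat :=
  match f with
  | Pos _ => 0
  | Eq s t => tsize s + tsize t
  | Bot => 0
  | Imp g h => rank g + rank h
  | All g => rank g * (rank g + rank g)
  end.

Fixpoint all_below (n : nat) (p : nat -> bool) : bool :=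
  match n with O => true | S k => andb (p k) (all_below k p) end.

(** A quantifier only has to range over finitely many values: rescaling the
    assignment by a multiple of all coefficients makes every solution of a
    relation an integer, and all these solutions, as well as one integer that
    satisfies no relation, are below an explicit bound. *)
Fixpoint ev (f : form) (env : list val) : bool :=
  match f with
  | Pos t => vpos (tev t env)
  | Eq s t => veqb (tev s env) (tev t env)
  | Bot => false
  | Imp g h => implb (ev g env) (ev h env)
  | All g =>
      let env' := env_scale (fact (rank g)) env in
      let B := S (S (rank g * env_size env')) in
      andb (ev g (Vzero :: env'))
        (all_below B (fun p => all_below B (fun n =>
           andb (ev g (Vnz true p n :: env')) (ev g (Vnz false p n :: env')))))
  end.

Lemma all_below_spec n p : all_below n p = true <-> forall k, k < n -> p k = true.
Proof.
  induction n as [|n IH]; simpl; [split; auto; lia|].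
  rewrite Bool.andb_true_iff, IH. split.
  - intros [H1 H2] k Hk. destruct (Nat.eq_dec k n) as [->|]; auto. apply H2. lia.
  - intros H. split; intros; apply H; lia.
Qed.

Definition env_elem (env : list val) (i : nat) : selem Zmod := val_elem (env_get i env).

Lemma env_get_nil n : env_get n [] = Vzero.
Proof. destruct n; reflexivity. Qed.

Lemma env_elem_cons v env i : vcons (val_elem v) (env_elem env) i = env_elem (v :: env) i.
Proof. destruct i; reflexivity. Qed.

Lemma val_elem_tev t env :
  val_elem (tev t env) = eval (signed Zmod) (env_elem env) t.
Proof.
  induction t; cbn -[zadd zsmul zzero]; auto.
  - rewrite <- IHt1, <- IHt2.
    destruct (tev t1 env), (tev t2 env); simpl; auto.
    do 2 f_equal. lia.
  - rewrite <- IHt. destruct (tev t env); cbn -[Z.mul]; auto. do 2 f_equal. lia.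
Qed.

Lemma veqb_spec v w : veqb v w = true <-> val_elem v = val_elem w.
Proof.
  destruct v as [|s p n], w as [|s' p' n']; simpl; try (intuition congruence).
  rewrite Bool.andb_true_iff, Bool.eqb_true_iff, Nat.eqb_eq. split.
  - intros [-> H]. do 2 f_equal. lia.
  - intros H. inversion H. split; auto. lia.
Qed.

Lemma vpos_spec v : vpos v = true <-> shape (val_elem v) = Some true.
Proof. destruct v as [|[]]; simpl; intuition congruence. Qed.

Lemma env_get_scale k : forall n env, env_get n (env_scale k env) = vscale k (env_get n env).
Proof. induction n; intros []; simpl; auto. Qed.

(** Scaling multiplies all values of [dot] by [k]. *)
Lemma agree_env_scale {V : zmodule} m N (rho : nat -> selem V) env k :
  k <> 0 -> agree m N rho (env_elem env) -> agree m N rho (env_elem (env_scale k env)).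
Proof.
  intros Hk [H1 H2]. split.
  - intros i Hi. rewrite (H1 i Hi). unfold env_elem. rewrite env_get_scale.
    destruct (env_get i env); reflexivity.
  - intros e He. rewrite (H2 e He).
    rewrite (dot_ext m e e (fun i => vec (env_elem (env_scale k env) i))
               (fun i => zsmul (Z.of_nat k) (vec (env_elem env i)))); auto.
    + rewrite dot_smul. split; [intros ->; apply zsmul_0_r|].
      apply Zmod_torsion_free. lia.
    + intros i _. unfold env_elem. rewrite env_get_scale.
      destruct (env_get i env); cbn; lia.
Qed.

Lemma dot_env_bound m N : forall e env, bounded m (Z.of_nat N) e ->
  (Z.abs (dot m e (fun i => vec (env_elem env i)) : Zmod) <= Z.of_nat (N * env_size env))%Z.
Proof.
  induction m as [|m IH]; intros e env He; [simpl; lia|].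
  assert (He' : bounded m (Z.of_nat N) (fun i => e (S i))) by (intros i Hi; apply He; lia).
  pose proof (He 0 ltac:(lia)) as He0.
  destruct env as [|v env].
  - specialize (IH (fun i => e (S i)) [] He').
    rewrite (dot_ext m (fun i => e (S i)) (fun i => e (S i))
       (fun i => vec (env_elem [] i)) (fun i => vec (env_elem [] (S i)))) in IH; auto.
    + simpl in *. lia.
    + intros i _. unfold env_elem. rewrite !env_get_nil. reflexivity.
  - specialize (IH (fun i => e (S i)) env He'). cbn in *.
    assert (Hv : (Z.abs (vec (val_elem v) : Z) <= Z.of_nat (vsize v))%Z)
      by (destruct v; cbn; lia).
    change (env_elem (v :: env) 0) with (val_elem v).
    change (fun i => vec (env_elem (v :: env) (S i))) with (fun i => vec (env_elem env i)).
    set (d := dot m _ _) in *. set (z := vec (val_elem v) : Z) in *.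
    cbn in d, z. clearbody d z. nia.
Qed.

Lemma fact_divide n k : 1 <= k <= n -> exists q, fact n = k * q.
Proof.
  induction n as [|n IH]; intros H; [lia|].
  destruct (Nat.eq_dec k (S n)) as [->|].
  - exists (fact n). reflexivity.
  - destruct IH as [q Hq]; [lia|]. exists (S n * q). simpl. rewrite Hq. lia.
Qed.

(** The integers are not divisible, but every coefficient up to [N] divides
    [fact N] and hence all entries of the scaled environment.  Since [dot] is at
    most [b := N * env_size] there, so are all solutions of relations, and
    [b + 1] satisfies none. *)
Lemma related_extend_env {V : zmodule} m N (u : nat -> V) env x :
  torsion_free V ->
  related m (2 * Z.of_nat N * Z.of_nat N) u
    (fun i => vec (env_elem (env_scale (fact N) env) i)) ->
  exists y : Z,
    (Z.abs y <= Z.of_nat (S (N * env_size (env_scale (fact N) env))))%Z /\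
    related (S m) (Z.of_nat N) (vcons x u)
      (vcons (y : Zmod) (fun i => vec (env_elem (env_scale (fact N) env) i))).
Proof.
  intros HV H.
  set (env' := env_scale (fact N) env) in *.
  apply (related_extend V Zmod m (Z.of_nat N) u (fun i => vec (env_elem env' i))
    (fun y : Z => Z.abs y <= Z.of_nat (S (N * env_size env')))%Z);
    auto using Zmod_torsion_free.
  - intros e k He Hk HkN.
    pose proof (dot_env_bound m N e env' He) as HB.
    destruct (fact_divide N (Z.abs_nat k)) as [q Hq]; [lia|].
    assert (Ed : exists z : Z, dot m e (fun i => vec (env_elem env' i)) = (k * z)%Z
                 :> Zmod).
    { exists (Z.sgn k * Z.of_nat q * (dot m e (fun i => vec (env_elem env i)) : Zmod))%Z.
      rewrite (dot_ext m e e (fun i => vec (env_elem env' i))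
        (fun i => zsmul (Z.of_nat (fact N)) (vec (env_elem env i)))); auto.
      - rewrite dot_smul, Hq. cbn. set (d := dot m _ _). cbn in d.
        rewrite Nat2Z.inj_mul, Zabs2Nat.id_abs, <- Z.sgn_abs. nia.
      - intros i _. unfold env', env_elem. rewrite env_get_scale.
        destruct (env_get i env); cbn; lia. }
    destruct Ed as [z Ez]. exists (- z)%Z. rewrite Ez in *. cbn in *.
    set (bb := (N * env_size env')) in *. clearbody bb.
    split; [nia|lia].
  - exists (Z.of_nat (S (N * env_size env'))). split; [cbn; lia|].
    intros e k He Hk HkN E. pose proof (dot_env_bound m N e env' He) as HB.
    set (d := dot m _ _) in *. cbn in *. clearbody d.
    set (bb := (N * env_size env')) in *. clearbody bb. nia.
Qed.

Lemma agree_extend_env {V : zmodule} m N (rho : nat -> selem V) env a :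
  torsion_free V ->
  agree m (2 * Z.of_nat N * Z.of_nat N) rho (env_elem env) ->
  let env' := env_scale (fact N) env in
  let B := S (S (N * env_size env')) in
  exists v, agree (S m) (Z.of_nat N) (vcons a rho) (env_elem (v :: env')) /\
    (v = Vzero \/ exists s p n, v = Vnz s p n /\ p < B /\ n < B).
Proof.
  intros HV H env' B. apply (agree_env_scale m _ rho env (fact N) (fact_neq_0 N)) in H.
  fold env' in H.
  assert (HN : agree m (Z.of_nat N) rho (env_elem env')).
  { eapply agree_mono; [|exact H]. nia. }
  destruct a as [[s x]|].
  - destruct (related_extend_env m N (fun i => vec (rho i)) env x HV (proj2 H))
      as (y & Hy & Hr). fold env' in Hy, Hr.
    set (p := Z.to_nat y). set (n := Z.to_nat (- y)).
    assert (Ey : (Z.of_nat p - Z.of_nat n)%Z = y) by lia.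
    exists (Vnz s p n). split.
    + eapply agree_ext; [intros; apply env_elem_cons|].
      apply agree_cons; auto. cbn [val_elem vec]. rewrite Ey. exact Hr.
    + right. exists s, p, n. split; auto. unfold B.
      set (bb := (N * env_size env')) in *. clearbody bb. lia.
  - exists Vzero. split; auto.
    eapply agree_ext; [intros; apply env_elem_cons|]. apply agree_cons_None, HN.
Qed.

(** Both directions of the back-and-forth argument are used for a quantifier:
    each value tried by the search has a counterpart in [V], and each element
    of [V] has a counterpart among the values tried. *)
Theorem ev_sat {V : zmodule} : torsion_free V -> divisible V -> nontrivial V ->
  forall f m (rho : nat -> selem V) env,
  closed_at m f -> agree m (Z.of_nat (rank f)) rho (env_elem env) ->
  sat (signed V) rho f <-> ev f env = true.
Proof.
  intros HT HD HN. induction f; intros m rho env Hf H; cbn [closed_at rank ev] in *.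
  - rewrite (agree_Pos _ _ _ _ _ H Hf). simpl.
    rewrite vpos_spec, val_elem_tev. reflexivity.
  - rewrite (agree_Eq m rho (env_elem env) t t0) by tauto. simpl.
    rewrite veqb_spec, !val_elem_tev. reflexivity.
  - simpl. intuition congruence.
  - simpl. rewrite (IHf1 m rho env), (IHf2 m rho env); try tauto;
      try (eapply agree_mono; [|exact H]; lia).
    destruct (ev f1 env), (ev f2 env); simpl; intuition congruence.
  - set (N := rank f) in *.
    replace (Z.of_nat (N * (N + N))) with (2 * Z.of_nat N * Z.of_nat N)%Z in H by lia.
    set (env' := env_scale (fact N) env) in *.
    set (B := S (S (N * env_size env'))).
    assert (back : forall v, exists a : selem V,
      agree (S m) (Z.of_nat N) (vcons a rho) (env_elem (v :: env'))).
    { intros v. apply (agree_env_scale m _ rho env (fact N) (fact_neq_0 N)) in H.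
      fold env' in H.
      assert (HN' : agree m (Z.of_nat N) rho (env_elem env')).
      { eapply agree_mono; [|exact H]. nia. }
      destruct v as [|s p n].
      - exists None. eapply agree_ext; [intros; apply env_elem_cons|].
        apply agree_cons_None, HN'.
      - apply agree_sym in H. destruct H as [_ H].
        destruct (related_extend_divisible Zmod V m N _ _
          (vec (val_elem (Vnz s p n))) Zmod_torsion_free HT HD HN H) as [x Hx].
        exists (Some (s, x)). eapply agree_ext; [intros; apply env_elem_cons|].
        apply agree_cons; auto. intros e He. symmetry. apply Hx, He. }
    assert (E : forall a, econs (signed V) a rho = vcons a rho) by reflexivity.
    rewrite Bool.andb_true_iff, all_below_spec. split.
    + intros Hsat.
      assert (Hv : forall v, ev f (v :: env') = true).
      { intros v. destruct (back v) as [a Ha]. apply (IHf (S m) (vcons a rho)); auto.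
        apply Hsat. }
      split; auto. intros p _. apply all_below_spec. intros n _. rewrite !Hv. auto.
    + intros [H0 H1] a.
      destruct (agree_extend_env m N rho env a HT H) as (v & Hv & Hc).
      apply (IHf (S m) (vcons a rho) (v :: env') Hf Hv).
      destruct Hc as [->|([] & p & n & -> & Hp & Hn)]; auto;
        specialize (H1 p Hp); rewrite all_below_spec in H1;
        specialize (H1 n Hn); apply Bool.andb_true_iff in H1; tauto.
Qed.

(** Through such an environment, [ev] also evaluates formulas with
    parameters. *)
Lemma exists_agree_env {V : zmodule} (HV : torsion_free V) :
  forall m N (rho : nat -> selem V),
  exists env, agree m (Z.of_nat N) rho (env_elem env).
Proof.
  induction m as [|m IH]; intros N rho.
  - exists []. split; [lia|]. intros e _. simpl. tauto.
  - destruct (IH (2 * N * N) (fun i => rho (S i))) as [env Henv].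
    destruct (agree_extend_env m N (fun i => rho (S i)) env (rho 0) HV) as (v & Hv & _).
    { eapply agree_mono; [|exact Henv]. lia. }
    eexists. apply agree_sym. eapply agree_ext; [|apply agree_sym, Hv].
    intros []; reflexivity.
Qed.

(** * Models of the axioms are signed vector spaces *)

(** ** Abelian groups as modules over the integers *)

Section GroupModule.
Variables (A : Type) (zero : A) (add : A -> A -> A) (opp : A -> A).
Hypothesis comm : forall x y, add x y = add y x.
Hypothesis assoc : forall x y z, add x (add y z) = add (add x y) z.
Hypothesis zero_l : forall x, add zero x = x.
Hypothesis opp_r : forall x, add x (opp x) = zero.

Fixpoint nmul (n : nat) (x : A) : A :=
  match n with O => zero | S k => add x (nmul k x) end.

Definition zmul (k : Z) (x : A) : A :=
  match k with
  | Z0 => zero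
  | Zpos p => nmul (Pos.to_nat p) x
  | Zneg p => opp (nmul (Pos.to_nat p) x)
  end.

Lemma group_zero_r x : add x zero = x.
Proof. rewrite comm. apply zero_l. Qed.

Lemma group_opp_unique x y : add x y = zero -> opp x = y.
Proof.
  intros H. rewrite <- (group_zero_r (opp x)), <- H, assoc, (comm (opp x)), opp_r.
  apply zero_l.
Qed.

Lemma zmul_of_nat n x : zmul (Z.of_nat n) x = nmul n x.
Proof.
  destruct n; cbn [Z.of_nat zmul]; auto. rewrite SuccNat2Pos.id_succ. reflexivity.
Qed.

Lemma zmul_opp_of_nat n x : zmul (- Z.of_nat n) x = opp (nmul n x).
Proof.
  destruct n; cbn [Z.of_nat Z.opp zmul].
  - symmetry. apply group_opp_unique, zero_l.
  - rewrite SuccNat2Pos.id_succ. reflexivity.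
Qed.

Lemma zmul_succ k x : zmul (Z.succ k) x = add x (zmul k x).
Proof.
  destruct (Z_le_gt_dec 0 k).
  - replace k with (Z.of_nat (Z.to_nat k)) by lia.
    rewrite <- Nat2Z.inj_succ, !zmul_of_nat. reflexivity.
  - replace k with (- Z.of_nat (S (Z.to_nat (- k - 1))))%Z by lia.
    set (n := Z.to_nat (- k - 1)).
    replace (Z.succ (- Z.of_nat (S n))) with (- Z.of_nat n)%Z by lia.
    rewrite !zmul_opp_of_nat. apply group_opp_unique. simpl.
    rewrite assoc, (comm (nmul n x)). apply opp_r.
Qed.

Lemma zmul_pred k x : zmul (Z.pred k) x = add (opp x) (zmul k x).
Proof.
  rewrite <- (Z.succ_pred k) at 2.
  rewrite zmul_succ, assoc, (comm (opp x)), opp_r, zero_l. reflexivity.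
Qed.

Lemma zmul_add_l a b x : zmul (a + b) x = add (zmul a x) (zmul b x).
Proof.
  induction a using Z.peano_ind.
  - simpl. symmetry. apply zero_l.
  - rewrite Z.add_succ_l, !zmul_succ, IHa, assoc. reflexivity.
  - rewrite Z.add_pred_l, !zmul_pred, IHa, assoc. reflexivity.
Qed.

Lemma group_swap x y z t : add (add x y) (add z t) = add (add x z) (add y t).
Proof.
  rewrite !assoc. f_equal. rewrite <- !assoc. f_equal. apply comm.
Qed.

Lemma zmul_add_r a x y : zmul a (add x y) = add (zmul a x) (zmul a y).
Proof.
  induction a using Z.peano_ind.
  - simpl. symmetry. apply zero_l.
  - rewrite !zmul_succ, IHa. apply group_swap.
  - rewrite !zmul_pred, IHa.
    rewrite (group_opp_unique (add x y) (add (opp x) (opp y))); [apply group_swap|].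
    rewrite group_swap, !opp_r. apply zero_l.
Qed.

Lemma zmul_mul a b x : zmul (a * b) x = zmul a (zmul b x).
Proof.
  induction a using Z.peano_ind.
  - reflexivity.
  - rewrite Z.mul_succ_l, Z.add_comm, zmul_add_l, zmul_succ, IHa. reflexivity.
  - rewrite Z.mul_pred_l, zmul_pred, <- IHa.
    rewrite <- Z.add_opp_r, zmul_add_l, comm. f_equal.
    symmetry. apply group_opp_unique. rewrite <- zmul_add_l, Z.add_opp_r, Z.sub_diag.
    reflexivity.
Qed.

Definition group_zmodule : zmodule.
Proof.
  refine (ZModule A zero add zmul comm assoc zero_l _ _ zmul_add_l zmul_add_r zmul_mul).
  - reflexivity.
  - intros x. apply group_zero_r.
Defined.

Lemma group_torsion_free :
  (forall n x, 1 <= n -> nmul n x = zero -> x = zero) -> torsion_free group_zmodule.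
Proof.
  intros H k x Hk E. simpl in *. destruct k as [|p|p]; simpl in E; [lia| |].
  - apply (H (Pos.to_nat p)); [lia|exact E].
  - apply (H (Pos.to_nat p)); [lia|].
    rewrite <- (opp_r (nmul (Pos.to_nat p) x)), E. symmetry. apply group_zero_r.
Qed.

Lemma group_divisible :
  (forall n x, 1 <= n -> exists y, nmul n y = x) -> divisible group_zmodule.
Proof.
  intros H k x Hk. simpl in *. destruct k as [|p|p]; [lia| |].
  - apply H. lia.
  - destruct (H (Pos.to_nat p) (opp x)) as [y Hy]; [lia|].
    exists y. simpl. rewrite Hy. apply group_opp_unique. rewrite comm. apply opp_r.
Qed.

End GroupModule.

(** ** Consequences of the axioms *)

Fixpoint mpow (M : structure) (x : M) (n : nat) : M :=
  match n with O => i_one M | S k => i_mul M x (mpow M x k) end.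

Section Model.
Variable M : structure.
Hypothesis HM : forall g, mul_axioms g -> models M g.

Local Notation "x * y" := (i_mul M x y).
Local Notation "x ^ n" := (mpow M x n).
Local Notation "0" := (i_zero M).
Local Notation "1" := (i_one M).
Local Notation "- 1" := (i_mone M).
Local Notation inv := (i_inv M).
Local Notation P := (i_pos M).
Local Notation opp x := (i_mul M (i_mone M) x).

Implicit Types x y z : M.

Local Notation axiom a := (HM _ a (fun _ => 0)).

Lemma M_assoc x y z : x * (y * z) = (x * y) * z.
Proof. exact (axiom ax_mul_assoc x y z). Qed.

Lemma M_one_r x : x * 1 = x.
Proof. exact (axiom ax_mul_one x). Qed.

Lemma M_inv_r x : x <> 0 -> x * inv x = 1.
Proof. exact (axiom ax_mul_inv x). Qed.

Lemma M_comm x y : x * y = y * x.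
Proof. exact (axiom ax_mul_comm x y). Qed.

Lemma M_zero_r x : x * 0 = 0.
Proof. pose proof (axiom ax_zero x) as H. apply sat_And in H. apply H. Qed.

Lemma M_inv_0 : inv 0 = 0.
Proof.
  pose proof (axiom ax_zero 0) as H. apply sat_And in H. symmetry. apply H.
Qed.

Lemma M_nontrivial : exists y, y <> i_mone M /\ y <> 0 /\ y <> 1.
Proof.
  pose proof (axiom ax_nontrivial) as H. apply sat_Ex in H. destruct H as [y H].
  rewrite !sat_And in H. exists y. exact H.
Qed.

Lemma M_tpow t n rho : 1 <= n -> eval M rho (tpow t n) = eval M rho t ^ n.
Proof.
  destruct n as [|n]; [lia|]. intros _. induction n as [|n IH].
  - simpl. symmetry. apply M_one_r.
  - change (tpow t (S (S n))) with (mul t (tpow t (S n))). cbn [eval].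
    rewrite IH. reflexivity.
Qed.

Lemma M_even_roots n x : 1 <= n -> x ^ (2 * n) = 1 <-> x = 1 \/ x = i_mone M.
Proof.
  intros Hn. pose proof (axiom (ax_even_roots n Hn) x) as H.
  apply sat_Iff in H. rewrite sat_Or in H. cbn [sat] in H.
  rewrite M_tpow in H by lia. exact H.
Qed.

Lemma M_odd_roots n x : exists y, x = y ^ (2 * n + 1).
Proof.
  destruct n as [|n]; [exists x; symmetry; apply M_one_r|].
  pose proof (axiom (ax_odd_roots (S n) ltac:(lia)) x) as H.
  apply sat_Ex in H. destruct H as [y H]. cbn [sat] in H.
  rewrite M_tpow in H by lia. exists y. exact H.
Qed.

Lemma M_pos_square x : P x <-> exists y, y <> 0 /\ x = y * y.
Proof.
  pose proof (axiom ax_pos_square x) as H. apply sat_Iff in H. rewrite sat_Ex in H.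
  rewrite H. split; intros [y Hy]; exists y.
  - apply sat_And in Hy. exact Hy.
  - apply sat_And. exact Hy.
Qed.

Lemma M_pos_neg x : x <> 0 -> ~ P x <-> P (opp x).
Proof.
  intros Hx. pose proof (axiom ax_pos_neg x Hx) as H. apply sat_Iff in H. exact H.
Qed.

Lemma M_pos_mul x y : x <> 0 -> y <> 0 -> P (x * y) <-> (P x <-> P y).
Proof.
  intros Hx Hy. pose proof (axiom ax_pos_mul x y) as H.
  cbn [sat] in H. rewrite !sat_Iff, sat_And in H. apply H. split; assumption.
Qed.

Lemma M_zero_l x : 0 * x = 0.
Proof. rewrite M_comm. apply M_zero_r. Qed.

Lemma M_one_l x : 1 * x = x.
Proof. rewrite M_comm. apply M_one_r. Qed.

Lemma M_one_neq_zero : 1 <> 0.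
Proof.
  intros H. destruct M_nontrivial as (y & _ & Hy & _). apply Hy.
  rewrite <- (M_one_r y), H. apply M_zero_r.
Qed.

Lemma M_inv_unique x y : x * y = 1 -> inv x = y.
Proof.
  intros H. assert (Hx : x <> 0).
  { intros ->. rewrite M_zero_l in H. apply M_one_neq_zero. auto. }
  rewrite <- (M_one_r (inv x)), <- H, M_assoc, (M_comm (inv x)), M_inv_r by auto.
  apply M_one_l.
Qed.

Lemma M_mul_neq_zero x y : x <> 0 -> y <> 0 -> x * y <> 0.
Proof.
  intros Hx Hy E. apply Hx.
  rewrite <- (M_one_r x), <- (M_inv_r y Hy), M_assoc, E. apply M_zero_l.
Qed.

Lemma M_pos_neq_zero x : P x -> x <> 0.
Proof.
  intros H. apply M_pos_square in H as (y & Hy & ->). apply M_mul_neq_zero; auto.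
Qed.

Lemma M_pos_one : P 1.
Proof.
  apply M_pos_square. exists 1. split; [apply M_one_neq_zero|].
  symmetry. apply M_one_r.
Qed.

Lemma M_not_pos_mone : ~ P (i_mone M).
Proof.
  intros H. rewrite <- (M_one_r (i_mone M)) in H.
  apply M_pos_neg in H; [|apply M_one_neq_zero]. apply H, M_pos_one.
Qed.

Lemma M_mone_square : i_mone M * i_mone M = 1.
Proof.
  pose proof (proj2 (M_even_roots 1 (i_mone M) (le_n 1)) (or_intror eq_refl)) as H.
  simpl in H. rewrite M_one_r in H. exact H.
Qed.

Lemma M_mone_neq_zero : i_mone M <> 0.
Proof.
  intros E. apply M_one_neq_zero. rewrite <- M_mone_square, E. apply M_zero_r.
Qed.

Lemma M_pos_times x y : P x -> P y -> P (x * y).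
Proof. intros Hx Hy. apply M_pos_mul; auto using M_pos_neq_zero; tauto. Qed.

Lemma M_inv_neq_zero x : x <> 0 -> inv x <> 0.
Proof.
  intros Hx E. apply M_one_neq_zero. rewrite <- (M_inv_r x Hx), E. apply M_zero_r.
Qed.

Lemma M_pos_inv x : P x -> P (inv x).
Proof.
  intros H. assert (Hx := M_pos_neq_zero x H).
  apply (M_pos_mul x (inv x)); auto using M_inv_neq_zero.
  rewrite M_inv_r; auto using M_pos_one.
Qed.

Lemma M_pow_add x m n : x ^ (m + n) = x ^ m * x ^ n.
Proof.
  induction m as [|m IH]; simpl; [symmetry; apply M_one_l|].
  rewrite IH. apply M_assoc.
Qed.

Lemma M_pow_mul x m n : x ^ (m * n) = (x ^ n) ^ m.
Proof. induction m as [|m IH]; simpl; auto. rewrite M_pow_add, IH. reflexivity. Qed.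

Lemma M_pow_neq_zero x n : x <> 0 -> x ^ n <> 0.
Proof.
  intros Hx. induction n; simpl; auto using M_one_neq_zero, M_mul_neq_zero.
Qed.

Lemma M_one_pow n : 1 ^ n = 1.
Proof. induction n; simpl; auto. rewrite IHn. apply M_one_r. Qed.

(** Doubling the exponent makes the axiom on even roots of unity applicable. *)
Lemma M_pos_torsion n x : 1 <= n -> P x -> x ^ n = 1 -> x = 1.
Proof.
  intros Hn Hx E.
  destruct (proj1 (M_even_roots n x Hn)) as [|E']; auto.
  - rewrite M_pow_mul, E. apply M_one_pow.
  - subst. destruct (M_not_pos_mone Hx).
Qed.

Lemma M_mone_mone x : opp (opp x) = x.
Proof. rewrite M_assoc, M_mone_square. apply M_one_l. Qed.

Lemma M_pos_sqrt x : P x -> exists y, P y /\ y * y = x.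
Proof.
  intros H. apply M_pos_square in H as (y & Hy & ->).
  destruct (classic (P y)) as [Py|Ny]; [eauto|].
  exists (opp y). split; [apply M_pos_neg; auto|].
  rewrite <- M_assoc, (M_assoc y), (M_comm y (i_mone M)), <- (M_assoc _ y y).
  apply M_mone_mone.
Qed.

(** Square roots and odd roots together give all roots. *)
Lemma M_pos_root n : 1 <= n -> forall x, P x -> exists y, P y /\ y ^ n = x.
Proof.
  induction n as [n IH] using lt_wf_ind. intros Hn x Hx.
  destruct (Nat.Even_or_Odd n) as [[m ->]|[m ->]].
  - destruct (M_pos_sqrt x Hx) as (z & Hz & <-).
    destruct (IH m ltac:(lia) ltac:(lia) z Hz) as (y & Hy & <-).
    exists y. split; auto. replace (2 * m)%nat with (m + m)%nat by lia. apply M_pow_add.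
  - destruct (M_odd_roots m x) as [y Hy].
    exists y. split; auto.
    assert (Hy0 : y <> 0).
    { intros ->. apply (M_pos_neq_zero x Hx). rewrite Hy, Nat.add_1_r. simpl.
      apply M_zero_l. }
    rewrite Hy, Nat.add_1_r in Hx. cbn [mpow] in Hx.
    apply M_pos_mul in Hx; auto using M_pow_neq_zero. apply Hx.
    apply M_pos_square. exists (y ^ m). split; auto using M_pow_neq_zero.
    replace (2 * m)%nat with (m + m)%nat by lia. apply M_pow_add.
Qed.

(** ** The positive elements as a module *)

Definition pos_elem : Type := { x : M | P x }.

Lemma pos_elem_eq (a b : pos_elem) : proj1_sig a = proj1_sig b -> a = b.
Proof. destruct a, b. apply subset_eq_compat. Qed.

Definition pos_one : pos_elem := exist _ 1 M_pos_one.

Definition pos_mul (a b : pos_elem) : pos_elem :=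
  exist _ (proj1_sig a * proj1_sig b) (M_pos_times _ _ (proj2_sig a) (proj2_sig b)).

Definition pos_inv (a : pos_elem) : pos_elem :=
  exist _ (inv (proj1_sig a)) (M_pos_inv _ (proj2_sig a)).

Lemma pos_mul_comm a b : pos_mul a b = pos_mul b a.
Proof. apply pos_elem_eq, M_comm. Qed.

Lemma pos_mul_assoc a b c : pos_mul a (pos_mul b c) = pos_mul (pos_mul a b) c.
Proof. apply pos_elem_eq, M_assoc. Qed.

Lemma pos_one_l a : pos_mul pos_one a = a.
Proof. apply pos_elem_eq, M_one_l. Qed.

Lemma pos_inv_r a : pos_mul a (pos_inv a) = pos_one.
Proof. apply pos_elem_eq, M_inv_r, M_pos_neq_zero, (proj2_sig a). Qed.

Definition pos_module : zmodule :=
  group_zmodule pos_elem pos_one pos_mul pos_inv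
    pos_mul_comm pos_mul_assoc pos_one_l pos_inv_r.

Lemma pos_nmul n a :
  proj1_sig (nmul pos_elem pos_one pos_mul n a) = proj1_sig a ^ n.
Proof. induction n; simpl; auto. rewrite IHn. reflexivity. Qed.

Lemma pos_module_torsion_free : torsion_free pos_module.
Proof.
  apply group_torsion_free. intros n a Hn E. apply pos_elem_eq.
  apply (f_equal (@proj1_sig _ _)) in E. rewrite pos_nmul in E.
  apply (M_pos_torsion n); auto. apply (proj2_sig a).
Qed.

Lemma pos_module_divisible : divisible pos_module.
Proof.
  apply group_divisible. intros n [x Hx] Hn.
  destruct (M_pos_root n Hn x Hx) as (y & Hy & E).
  exists (exist _ y Hy). apply pos_elem_eq. rewrite pos_nmul. exact E.
Qed.

Lemma pos_module_nontrivial : nontrivial pos_module.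
Proof.
  destruct M_nontrivial as (y & H1 & H2 & H3).
  assert (Hy : P (y * y)) by (apply M_pos_square; eauto).
  exists (exist _ (y * y) Hy : pos_module). intros E.
  apply (f_equal (@proj1_sig _ _)) in E. simpl in E.
  destruct (proj1 (M_even_roots 1 y (le_n 1))); auto.
  simpl. rewrite M_one_r. exact E.
Qed.

(** ** The isomorphism *)

Definition of_signed (a : selem pos_module) : M :=
  match a with
  | None => 0
  | Some (true, x) => proj1_sig x
  | Some (false, x) => opp (proj1_sig x)
  end.

Lemma of_signed_surj x : exists a, of_signed a = x.
Proof.
  destruct (classic (x = 0)) as [->|Hx]; [exists None; reflexivity|].
  destruct (classic (P x)) as [Hp|Hp].
  - exists (Some (true, exist _ x Hp)). reflexivity.
  - apply M_pos_neg in Hp; auto.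
    exists (Some (false, exist _ _ Hp)). apply M_mone_mone.
Qed.

Lemma of_signed_pos a : P (of_signed a) <-> shape a = Some true.
Proof.
  destruct a as [[[] [x Hx]]|]; simpl.
  - tauto.
  - split; [|discriminate]. intros H.
    apply M_pos_neg in H; auto using M_pos_neq_zero. contradiction.
  - split; [|discriminate]. intros H. destruct (M_pos_neq_zero _ H eq_refl).
Qed.

Lemma of_signed_inj a b : of_signed a = of_signed b -> a = b.
Proof.
  intros E. pose proof (of_signed_pos a) as Ha. pose proof (of_signed_pos b) as Hb.
  rewrite E in Ha.
  destruct a as [[[] [x Hx]]|], b as [[[] [y Hy]]|]; cbn in E, Ha, Hb; auto;
    try (exfalso; assert (Some false = Some true) by tauto; discriminate);
    try (exfalso; assert (None = Some true) by tauto; discriminate).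
  - do 2 f_equal. apply pos_elem_eq. exact E.
  - do 2 f_equal. apply pos_elem_eq. simpl.
    rewrite <- (M_mone_mone x), E. apply M_mone_mone.
  - destruct (M_mul_neq_zero _ _ M_mone_neq_zero (M_pos_neq_zero x Hx) E).
  - destruct (M_mul_neq_zero _ _ M_mone_neq_zero (M_pos_neq_zero y Hy)). auto.
Qed.

Lemma of_signed_mul a b : of_signed (smul_elem a b) = of_signed a * of_signed b.
Proof.
  destruct a as [[[] [x Hx]]|], b as [[[] [y Hy]]|]; simpl;
    rewrite ?M_zero_l, ?M_zero_r; auto.
  - rewrite !M_assoc, (M_comm x). reflexivity.
  - apply M_assoc.
  - rewrite !M_assoc. f_equal.
    rewrite (M_comm (i_mone M) x), <- M_assoc, M_mone_square, M_one_r. reflexivity.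
Qed.

Lemma of_signed_inv a : of_signed (sinv_elem a) = inv (of_signed a).
Proof.
  destruct a as [[[] [x Hx]]|]; simpl.
  - rewrite M_one_r. reflexivity.
  - rewrite M_one_r. symmetry. apply M_inv_unique.
    rewrite (M_comm (i_mone M) x), M_assoc, <- (M_assoc x), M_mone_square, M_one_r.
    apply M_inv_r, M_pos_neq_zero, Hx.
  - symmetry. apply M_inv_0.
Qed.

Lemma of_signed_eval rho t :
  eval M (fun i => of_signed (rho i)) t = of_signed (eval (signed pos_module) rho t).
Proof.
  induction t; simpl; auto.
  - symmetry. apply M_one_r.
  - rewrite IHt1, IHt2. symmetry. apply of_signed_mul.
  - rewrite IHt. symmetry. apply of_signed_inv.
Qed.

Lemma of_signed_sat f : forall rho,
  sat M (fun i => of_signed (rho i)) f <-> sat (signed pos_module) rho f.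
Proof.
  induction f; intros rho; simpl.
  - rewrite of_signed_eval. apply of_signed_pos.
  - rewrite !of_signed_eval. split; [apply of_signed_inj|intros E; f_equal; exact E].
  - tauto.
  - rewrite IHf1, IHf2. tauto.
  - assert (E : forall a, sat M (econs M (of_signed a) (fun i => of_signed (rho i))) f
              <-> sat (signed pos_module) (econs (signed pos_module) a rho) f).
    { intros a. rewrite <- IHf. apply sat_ext. intros []; reflexivity. }
    split.
    + intros H a. apply E, H.
    + intros H x. destruct (of_signed_surj x) as [a <-]. apply E, H.
Qed.

End Model.

(** Every element is zero, positive, or minus one times a positive element, and
    only one of these. *)
Theorem model_presentation (M : structure) (rho : nat -> M) :
  (forall g, mul_axioms g -> models M g) ->
  exists (V : zmodule) (tau : nat -> selem V),
    torsion_free V /\ divisible V /\ nontrivial V /\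
    forall f, sat M rho f <-> sat (signed V) tau f.
Proof.
  intros HM. exists (pos_module M HM).
  exists (fun i => proj1_sig (constructive_indefinite_description _
                                (of_signed_surj M HM (rho i)))).
  split; [apply pos_module_torsion_free|]. split; [apply pos_module_divisible|].
  split; [apply pos_module_nontrivial|]. intros f.
  rewrite <- of_signed_sat. apply sat_ext. intros n. symmetry.
  apply (proj2_sig (constructive_indefinite_description _ (of_signed_surj M HM (rho n)))).
Qed.

(** * The real numbers *)

Local Open Scope R_scope.

Lemma R_tpow t n rho : (1 <= n)%nat -> eval R_struct rho (tpow t n) = eval R_struct rho t ^ n.
Proof.
  destruct n as [|n]; [lia|]. intros _. induction n as [|n IH].
  - simpl. lra.
  - change (tpow t (S (S n))) with (mul t (tpow t (S n))). cbn [eval].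
    rewrite IH. reflexivity.
Qed.

Lemma R_even_roots n x : (1 <= n)%nat -> x ^ (2 * n) = 1 <-> x = 1 \/ x = -1.
Proof.
  intros Hn. split.
  - intros H. apply pow_R1 in H as [H|H]; [|lia].
    unfold Rabs in H. destruct (Rcase_abs x); [right|left]; lra.
  - intros [->| ->]; [apply pow1|apply pow_1_even].
Qed.

Lemma R_odd_roots n x : exists y, x = y ^ (2 * n + 1).
Proof.
  assert (H : forall x, 0 < x -> exists y, x = y ^ (2 * n + 1)).
  { intros z Hz. exists (Rpower z (/ INR (2 * n + 1))).
    rewrite <- Rpower_pow by apply exp_pos. rewrite Rpower_mult, Rinv_l.
    - symmetry. apply Rpower_1, Hz.
    - apply not_0_INR. lia. }
  destruct (Rtotal_order x 0) as [Hx|[->|Hx]].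
  - destruct (H (- x)) as [y Hy]; [lra|]. exists (-1 * y).
    rewrite Rpow_mult_distr, <- Hy, Nat.add_1_r, pow_1_odd. lra.
  - exists 0. rewrite pow_i; [reflexivity|lia].
  - apply H, Hx.
Qed.

Lemma R_pos_mul x y : x <> 0 -> y <> 0 -> 0 < x * y <-> (0 < x <-> 0 < y).
Proof. intros. split; [intros; split; intros; nra|]. intros. nra. Qed.

Lemma R_satisfies_axioms g : mul_axioms g -> models R_struct g.
Proof.
  intros [| | | | | |n Hn|n Hn| | |]; intros rho.
  - intros x y z. simpl. ring.
  - intros x. simpl. ring.
  - intros x Hx. simpl. apply Rinv_r, Hx.
  - intros x y. simpl. ring.
  - apply sat_Ex. exists 2. rewrite !sat_And. simpl. lra.
  - intros x. rewrite sat_And. simpl. rewrite Rinv_0. split; [ring|reflexivity].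
  - intros x. rewrite sat_Iff, sat_Or. cbn [sat]. rewrite R_tpow by lia.
    apply R_even_roots, Hn.
  - intros x. apply sat_Ex. destruct (R_odd_roots n x) as [y Hy]. exists y.
    cbn [sat]. rewrite R_tpow by lia. exact Hy.
  - intros x. rewrite sat_Iff, sat_Ex. split.
    + intros Hx. exists (sqrt x). apply sat_And. simpl in *.
      rewrite sqrt_sqrt by lra. split; auto. intros E. apply sqrt_eq_0 in E; lra.
    + intros [y Hy]. apply sat_And in Hy. simpl in *. destruct Hy. nra.
  - intros x Hx. rewrite sat_Iff. simpl in *. lra.
  - intros x y H. apply sat_And in H. rewrite !sat_Iff. apply R_pos_mul; apply H.
Qed.

Local Close Scope R_scope.

(** * Completeness and quantifier elimination of the theory *)

Lemma mul_axioms_sentence g : mul_axioms g -> sentence g.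
Proof.
  assert (T : forall k t, term_closed_at k t -> forall n, term_closed_at k (tpow t n)).
  { intros k t Ht [|n]; [exact I|]. induction n as [|n IH]; [exact Ht|].
    change (tpow t (S (S n))) with (mul t (tpow t (S n))). split; auto. }
  unfold sentence.
  destruct 1; cbn -[Nat.mul tpow]; repeat split; try apply T; cbn; try lia.
Qed.

(** The empty environment agrees with every assignment on no variables, so the
    value of a sentence is the same in all models. *)
Lemma model_sat_ev (M : structure) (rho : nat -> M) f :
  (forall g, mul_axioms g -> models M g) -> sentence f ->
  sat M rho f <-> ev f [] = true.
Proof.
  intros HM Hf.
  destruct (model_presentation M rho HM) as (V & tau & H1 & H2 & H3 & H4).
  rewrite H4. apply (ev_sat H1 H2 H3 f 0); auto.
  split; [lia|]. intros e _. simpl. tauto.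
Qed.

Lemma proves_iff_ev f : sentence f -> proves mul_axioms f <-> ev f [] = true.
Proof.
  intros Hf. split.
  - intros (A & HA & p).
    apply (model_sat_ev R_struct (fun _ => 0%R) f R_satisfies_axioms Hf).
    apply (soundness A f p). intros g Hg. apply R_satisfies_axioms, HA, Hg.
  - intros H. apply completeness; [apply mul_axioms_sentence|].
    intros M HM rho. apply (model_sat_ev M rho f HM Hf), H.
Qed.

Theorem mul_axioms_complete : completely_axiomatizes mul_axioms R_struct.
Proof.
  intros f Hf. rewrite (proves_iff_ev f Hf).
  rewrite <- (model_sat_ev R_struct (fun _ => 0%R) f R_satisfies_axioms Hf). split.
  - intros H. apply H.
  - apply sat_sentence, Hf.
Qed.

(** ** Quantifier elimination *)

(** A class of assignments that is invariant under agreement on finitely many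
    quantifier-free formulas is defined by a Boolean combination of them:
    split on the first formula and continue with both halves. *)
Lemma definable_by_finite_list (T : theory) (L : list form) :
  (forall a, In a L -> quantifier_free a) ->
  forall F : forall M : structure, (nat -> M) -> Prop,
  (forall M M' rho rho', (forall g, T g -> models M g) -> (forall g, T g -> models M' g) ->
     (forall a, In a L -> sat M rho a <-> sat M' rho' a) -> F M rho -> F M' rho') ->
  exists g, quantifier_free g /\
    forall M rho, (forall g, T g -> models M g) -> sat M rho g <-> F M rho.
Proof.
  induction L as [|a L IH]; intros HL F HF.
  - destruct (classic (exists M rho, (forall g, T g -> models M g) /\ F M rho))
      as [(M0 & rho0 & H0 & HF0)|N].
    + exists (Imp Bot Bot). split; [simpl; auto|]. intros M rho HM. simpl.
      split; [|tauto]. intros _. apply (HF M0 M rho0 rho); auto. intros b [].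
    + exists Bot. split; [simpl; auto|]. intros M rho HM. simpl. split; [tauto|].
      intros H. apply N. eauto.
  - set (half := fun (s : Prop) (M : structure) (rho : nat -> M) =>
      exists (M' : structure) (rho' : nat -> M'), (forall g, T g -> models M' g) /\
        (forall b, In b L -> sat M rho b <-> sat M' rho' b) /\
        (sat M' rho' a <-> s) /\ F M' rho').
    assert (D : forall s, exists g, quantifier_free g /\
      forall M rho, (forall g, T g -> models M g) -> sat M rho g <-> half s M rho).
    { intros s. apply IH; [intros; apply HL; simpl; auto|].
      intros M M' rho rho' HM HM' HL' (M2 & rho2 & H1 & H2 & H3 & H4).
      exists M2, rho2. split; [exact H1|]. split; [|auto].
      intros b Hb. rewrite <- (HL' b Hb). apply H2, Hb. }
    destruct (D True) as (g1 & Q1 & H1), (D False) as (g2 & Q2 & H2).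
    exists (And (Imp a g1) (Imp (Not a) g2)).
    split; [simpl; intuition (apply HL; simpl; auto)|].
    intros M rho HM. rewrite sat_And. cbn [sat]. rewrite H1, H2 by auto.
    assert (G : forall s : Prop, (sat M rho a <-> s) -> half s M rho <-> F M rho).
    { intros s Hs. split.
      - intros (M' & rho' & HM' & HL' & Ha & HF').
        apply (HF M' M rho' rho HM' HM); auto.
        intros b [<-|Hb]; [tauto|]. symmetry. apply HL', Hb.
      - intros HFM. exists M, rho. split; [exact HM|]. split; [reflexivity|auto]. }
    destruct (classic (sat M rho a)) as [Ha|Ha].
    + rewrite (G True) by tauto. simpl. tauto.
    + rewrite (G False) by tauto. simpl. tauto.
Qed.

(** The monomial with exponents [e]; variables of exponent 0 must not occur in
    it, since their value may be zero. *)
Definition tpow_z (t : term) (k : Z) : term :=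
  match k with
  | Z0 => one
  | Zpos p => tpow t (Pos.to_nat p)
  | Zneg p => inv (tpow t (Pos.to_nat p))
  end.

Fixpoint monomial (m : nat) (e : nat -> Z) : term :=
  match m with
  | O => one
  | S n => mul (monomial n e) (tpow_z (var n) (e n))
  end.

Lemma coef_tpow t i n : coef (tpow t n) i = (Z.of_nat n * coef t i)%Z.
Proof.
  destruct n as [|n]; [reflexivity|]. induction n as [|n IH].
  - cbn [tpow]. lia.
  - change (tpow t (S (S n))) with (mul t (tpow t (S n))). cbn [coef].
    rewrite IH. lia.
Qed.

Lemma coef_tpow_z t i k : coef (tpow_z t k) i = (k * coef t i)%Z.
Proof.
  destruct k as [|p|p]; cbn [tpow_z coef]; rewrite ?coef_tpow; lia.
Qed.

Lemma coef_monomial m e i : coef (monomial m e) i = if i <? m then e i else 0%Z.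
Proof.
  induction m as [|m IH]; [reflexivity|]. cbn [monomial coef].
  rewrite IH, coef_tpow_z. cbn [coef].
  destruct (Nat.ltb_spec i m), (Nat.ltb_spec i (S m)), (Nat.eqb_spec m i);
    subst; try lia.
Qed.

Lemma monomial_closed m e : term_closed_at m (monomial m e).
Proof.
  induction m as [|m IH]; simpl; auto. split.
  - eapply term_closed_at_mono; [|exact IH]. lia.
  - assert (T : forall n, term_closed_at (S m) (tpow (var m) n)).
    { intros [|n]; [exact I|]. induction n as [|n IHn]; [simpl; lia|].
      change (tpow (var m) (S (S n))) with (mul (var m) (tpow (var m) (S n))).
      split; [simpl; lia|auto]. }
    destruct (e m); simpl; auto.
Qed.

Lemma monomial_nonzero {V : zmodule} m e (rho : nat -> selem V) :
  (forall i, i < m -> rho i = None -> e i = 0%Z) ->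
  eval (signed V) rho (monomial m e) <> None.
Proof.
  assert (A : forall a b : selem V, a <> None -> b <> None -> smul_elem a b <> None).
  { intros [[]|] [[]|]; simpl; congruence. }
  induction m as [|m IH]; intros H; [simpl; congruence|].
  cbn [monomial eval]. apply A; [apply IH; auto|].
  destruct (rho m) eqn:E.
  - assert (T : forall n, eval (signed V) rho (tpow (var m) n) <> None).
    { intros [|n]; [simpl; congruence|]. induction n as [|n IHn]; [simpl; congruence|].
      change (tpow (var m) (S (S n))) with (mul (var m) (tpow (var m) (S n))).
      apply A; auto. simpl. congruence. }
    destruct (e m) as [|k|k]; cbn [tpow_z]; [simpl; congruence|apply T|].
    specialize (T (Pos.to_nat k)). cbn [eval signed i_inv].
    destruct (eval (signed V) rho (tpow (var m) (Pos.to_nat k))); simpl; congruence.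
  - rewrite H by auto. simpl. congruence.
Qed.

(** Squaring removes the sign, which a relation between exponents ignores. *)
Definition relation_form (m : nat) (e : nat -> Z) : form :=
  Eq (mul (monomial m e) (monomial m e)) one.

Lemma sat_relation_form {V : zmodule} m e (rho : nat -> selem V) :
  torsion_free V -> (forall i, i < m -> rho i = None -> e i = 0%Z) ->
  sat (signed V) rho (relation_form m e) <-> dot m e (fun i => vec (rho i)) = zzero.
Proof.
  intros HV He. pose proof (monomial_nonzero m e rho He) as Hn.
  pose proof (vec_eval m rho _ (monomial_closed m e) Hn) as Hv.
  rewrite (dot_ext m (coef (monomial m e)) e _ (fun i => vec (rho i))) in Hv; auto.
  2:{ intros i Hi. rewrite coef_monomial. destruct (Nat.ltb_spec i m); [auto|lia]. }
  rewrite <- Hv. cbn [relation_form sat eval signed i_mul i_one].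
  destruct (eval (signed V) rho (monomial m e)) as [[s x]|]; [|congruence].
  simpl. rewrite Bool.eqb_reflx. split.
  - intros E. apply (HV 2%Z); [lia|]. change 2%Z with (1 + 1)%Z.
    rewrite zsmul_add_l, !zsmul_1_l. congruence.
  - intros ->. rewrite zadd_0_l. reflexivity.
Qed.

(** The first two groups of formulas determine the shapes, the third one the
    relations that [agree] compares. *)
Definition type_forms (m N : nat) : list form :=
  map (fun i => Pos (var i)) (seq 0 m) ++
  map (fun i => Eq (var i) zero) (seq 0 m) ++
  map (relation_form m) (box m N).

Lemma type_forms_qf m N a : In a (type_forms m N) -> quantifier_free a.
Proof.
  unfold type_forms. rewrite !in_app_iff, !in_map_iff.
  intros [(i & <- & _)|[(i & <- & _)|(e & <- & _)]]; simpl; auto.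
Qed.

Lemma type_forms_agree {V W : zmodule} m N (rho : nat -> selem V) (tau : nat -> selem W) :
  torsion_free V -> torsion_free W ->
  (forall a, In a (type_forms m N) -> sat (signed V) rho a <-> sat (signed W) tau a) ->
  agree m (Z.of_nat N) rho tau.
Proof.
  intros HV HW H.
  assert (Hs : forall i, i < m -> shape (rho i) = shape (tau i)).
  { intros i Hi.
    assert (P : sat (signed V) rho (Pos (var i)) <-> sat (signed W) tau (Pos (var i))).
    { apply H, in_app_iff. left. apply (in_map (fun i => Pos (var i))), in_seq. lia. }
    assert (Z : sat (signed V) rho (Eq (var i) zero) <->
                sat (signed W) tau (Eq (var i) zero)).
    { apply H, in_app_iff. right. apply in_app_iff. left.
      apply (in_map (fun i => Eq (var i) zero)), in_seq. lia. }
    simpl in P, Z.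
    destruct (rho i) as [[[] x]|], (tau i) as [[[] y]|]; simpl in *; auto; exfalso;
      try (assert (Some false = Some true) by tauto; discriminate);
      try (assert (None = Some (true, x)) by intuition congruence; discriminate);
      try (assert (None = Some (true, y)) by intuition congruence; discriminate);
      intuition congruence. }
  split; auto. intros e He.
  (* A zero entry contributes nothing to [dot]; setting its coefficient to 0
     removes the variable from the monomial, which would vanish otherwise. *)
  set (e0 := fun i => match rho i with None => 0%Z | _ => e i end).
  assert (He0 : bounded m (Z.of_nat N) e0).
  { intros i Hi. unfold e0. specialize (He i Hi). destruct (rho i); [auto|simpl; lia]. }
  destruct (box_complete m N e0 He0) as (e' & He' & Hee').
  assert (Hf := H _ (in_or_app _ _ _ (or_intror (in_or_app _ _ _ (or_intror
                      (in_map (relation_form m) _ _ He')))))).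
  rewrite !sat_relation_form in Hf; auto.
  - assert (E : forall (U : zmodule) (ups : nat -> selem U),
      (forall i, i < m -> shape (rho i) = shape (ups i)) ->
      dot m e' (fun i => vec (ups i)) = dot m e (fun i => vec (ups i))).
    { intros U ups Hups. clear - Hee' Hups.
      assert (G : forall i, i < m -> zsmul (e' i) (vec (ups i)) = zsmul (e i) (vec (ups i))).
      { intros i Hi. rewrite <- Hee' by auto. unfold e0. specialize (Hups i Hi).
        destruct (rho i), (ups i); simpl in *; try congruence.
        rewrite !zsmul_0_r. reflexivity. }
      clear - G. revert e e' ups G.
      induction m as [|m IH]; intros e e' ups G; simpl; auto.
      rewrite G by lia. f_equal.
      apply (IH (fun i => e (S i)) (fun i => e' (S i)) (fun i => ups (S i))).
      intros i Hi. apply G. lia. }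
    rewrite <- (E V rho), <- (E W tau); auto.
  - intros i Hi Hn. rewrite <- Hee' by auto. unfold e0. specialize (Hs i Hi).
    rewrite Hn in Hs. destruct (rho i); [discriminate|reflexivity].
  - intros i Hi Hn. rewrite <- Hee' by auto. unfold e0. rewrite Hn. reflexivity.
Qed.

(** Two assignments that coincide on [type_forms] agree with the same
    environment, so [f] has the same value under both of them. *)
Theorem mul_axioms_QE : admits_QE mul_axioms.
Proof.
  intros f. set (m := form_bound f). set (N := rank f).
  destruct (definable_by_finite_list mul_axioms (type_forms m N) (type_forms_qf m N)
              (fun M rho => sat M rho f)) as (g & Hg & Hfg).
  - intros M M' rho rho' HM HM' HL.
    destruct (model_presentation M rho HM) as (V & tau & V1 & V2 & V3 & V4).
    destruct (model_presentation M' rho' HM') as (W & ups & W1 & W2 & W3 & W4).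
    rewrite V4, W4.
    assert (Ha : agree m (Z.of_nat N) tau ups).
    { apply type_forms_agree; auto. intros a Ha. rewrite <- V4, <- W4. auto. }
    destruct (exists_agree_env V1 m N tau) as [env Henv].
    rewrite (ev_sat V1 V2 V3 f m tau env (form_bound_closed f) Henv).
    rewrite (ev_sat W1 W2 W3 f m ups env (form_bound_closed f)); auto.
    eapply agree_trans; [apply agree_sym, Ha|exact Henv].
  - exists g. split; auto. apply completeness; [apply mul_axioms_sentence|].
    intros M HM rho. apply sat_Iff. symmetry. apply Hfg, HM.
Qed.

(** * Programming in the lambda-calculus *)

#[local] Instance lreduces_preorder : PreOrder lreduces.
Proof.
  split.
  - intros s. apply rt_refl.
  - intros s t u. apply rt_trans.
Qed.

#[local] Instance lapp_proper : Proper (lreduces ==> lreduces ==> lreduces) lapp.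
Proof.
  intros s s' Hs t t' Ht. transitivity (lapp s' t).
  - clear Ht. induction Hs; [apply rt_step, lstep_appL; auto|reflexivity|].
    etransitivity; eauto.
  - clear Hs. induction Ht; [apply rt_step, lstep_appR; auto|reflexivity|].
    etransitivity; eauto.
Qed.

Definition value (v : lterm) : Prop := lclosed v /\ exists s, v = llam s.

Lemma lsubst_closed_at s : forall k u, lclosed_at k s -> lsubst s k u = s.
Proof.
  induction s; simpl; intros k u H.
  - destruct (Nat.eqb_spec n k); [lia|reflexivity].
  - rewrite IHs1, IHs2; tauto.
  - rewrite IHs; auto.
Qed.

Lemma lclosed_at_mono s : forall k l, k <= l -> lclosed_at k s -> lclosed_at l s.
Proof.
  induction s; simpl; intros k l Hkl H; [lia| |].
  - split; [eapply IHs1|eapply IHs2]; eauto; tauto.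
  - eapply IHs; [|exact H]. lia.
Qed.

Lemma lsubst_value v k u : value v -> lsubst v k u = v.
Proof.
  intros [H _]. apply lsubst_closed_at. eapply lclosed_at_mono; [|exact H]. lia.
Qed.

(** ** A notation with named variables *)

Inductive exp : Type :=
| Var : string -> exp
| App : exp -> exp -> exp
| Lam : string -> exp -> exp.

Coercion Var : string >-> exp.
Declare Scope exp_scope.
Delimit Scope exp_scope with exp.
Bind Scope exp_scope with exp.
Local Notation "s @ t" := (App s t) (at level 40, left associativity) : exp_scope.
Local Notation "'fn' x => e" := (Lam x e) (at level 60, right associativity) : exp_scope.

Definition venv : Type := list (string * lterm).

Fixpoint index (x : string) (bd : list string) : option nat :=
  match bd with
  | [] => None
  | y :: l => if String.eqb x y then Some 0 else option_map S (index x l)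
  end.

Fixpoint lookup (x : string) (G : venv) : lterm :=
  match G with
  | [] => ltrue
  | (y, v) :: l => if String.eqb x y then v else lookup x l
  end.

(** [bd] lists the variables bound by enclosing abstractions; all others stand
    for the closed values that [G] assigns to them. *)
Fixpoint comp (bd : list string) (G : venv) (e : exp) : lterm :=
  match e with
  | Var x => match index x bd with Some i => lvar i | None => lookup x G end
  | App s t => lapp (comp bd G s) (comp bd G t)
  | Lam x s => llam (comp (x :: bd) G s)
  end.

Definition venv_ok (G : venv) : Prop := Forall (fun p => value (snd p)) G.

Lemma lookup_value x G : venv_ok G -> value (lookup x G).
Proof.
  induction 1 as [|[y v] G Hv HG IH]; simpl.
  - split; [unfold lclosed; simpl; lia|eexists; reflexivity].
  - destruct (String.eqb x y); auto.
Qed.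

Lemma index_lt x bd i : index x bd = Some i -> i < List.length bd.
Proof.
  revert i. induction bd as [|y bd IH]; simpl; [discriminate|]. intros i.
  destruct (String.eqb x y); [intros [= <-]; lia|].
  destruct (index x bd) as [j|]; simpl; [|discriminate].
  intros [= <-]. specialize (IH j eq_refl). lia.
Qed.

Lemma index_snoc x y bd :
  index x (bd ++ [y]) =
  match index x bd with
  | Some i => Some i
  | None => if String.eqb x y then Some (List.length bd) else None
  end.
Proof.
  induction bd as [|z bd IH]; simpl; [destruct (String.eqb x y); auto|].
  destruct (String.eqb x z); auto. rewrite IH.
  destruct (index x bd); simpl; auto. destruct (String.eqb x y); auto.
Qed.

Lemma comp_closed G e : venv_ok G -> forall bd, lclosed_at (List.length bd) (comp bd G e).
Proof.
  intros HG. induction e; intros bd; simpl; auto.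
  - destruct (index s bd) as [i|] eqn:E; [apply index_lt in E; exact E|].
    eapply lclosed_at_mono; [|apply lookup_value, HG]. lia.
  - apply (IHe (s :: bd)).
Qed.

(** Substituting for a bound variable extends the environment.  Hence reduction
    never has to be followed inside a term: a function applied to a value
    becomes its body in a larger environment ([clo_beta]). *)
Lemma lsubst_comp G x v e : venv_ok G -> forall bd,
  lsubst (comp (bd ++ [x]) G e) (List.length bd) v = comp bd ((x, v) :: G) e.
Proof.
  intros HG. induction e as [y|s IHs t IHt|y s IHs]; intros bd; simpl.
  - rewrite index_snoc. destruct (index y bd) as [i|] eqn:E.
    + apply index_lt in E. simpl. destruct (Nat.eqb_spec i (List.length bd)); [lia|auto].
    + destruct (String.eqb y x); simpl; [rewrite Nat.eqb_refl; auto|].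
      apply lsubst_value, lookup_value, HG.
  - rewrite IHs, IHt. reflexivity.
  - f_equal. apply (IHs (y :: bd)).
Qed.

Definition clo (G : venv) (x : string) (e : exp) : lterm := comp [] G (Lam x e).

Lemma clo_value G x e : venv_ok G -> value (clo G x e).
Proof.
  intros HG. split; [apply (comp_closed G (Lam x e) HG [])|eexists; reflexivity].
Qed.

Lemma clo_beta G x e v : venv_ok G -> value v ->
  lreduces (lapp (clo G x e) v) (comp [] ((x, v) :: G) e).
Proof.
  intros HG [_ [s ->]]. rewrite <- (lsubst_comp G x (llam s) e HG []).
  apply rt_step, lstep_beta.
Qed.

Lemma comp_App G s t : comp [] G (App s t) = lapp (comp [] G s) (comp [] G t).
Proof. reflexivity. Qed.

Lemma comp_Lam G x e : comp [] G (Lam x e) = clo G x e.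
Proof. reflexivity. Qed.

Lemma comp_Var G x : comp [] G (Var x) = lookup x G.
Proof. reflexivity. Qed.

(** Call-by-value recursion: [fixv G f x e] behaves as the function
    [fun x => e] in which [f] denotes that function.  The term
    [turing_half turing_half] is Turing's fixed-point combinator, eta-expanded so
    that it stops at a value. *)
Definition turing_half : lterm :=
  llam (llam (lapp (lvar 0)
    (llam (lapp (lapp (lapp (lvar 2) (lvar 2)) (lvar 1)) (lvar 0))))).

Definition fixv (G : venv) (f x : string) (e : exp) : lterm :=
  llam (lapp (lapp (lapp turing_half turing_half) (clo G f (Lam x e))) (lvar 0)).

Lemma fixv_value G f x e : venv_ok G -> value (fixv G f x e).
Proof.
  intros HG. split; [|eexists; reflexivity].
  unfold lclosed, fixv. cbn -[clo]. repeat split; try lia.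
  eapply lclosed_at_mono; [|apply (clo_value G f (Lam x e) HG)]. lia.
Qed.

Lemma fixv_beta G f x e v : venv_ok G -> value v ->
  lreduces (lapp (fixv G f x e) v) (comp [] ((x, v) :: (f, fixv G f x e) :: G) e).
Proof.
  intros HG Hv. pose proof (clo_value G f (Lam x e) HG) as Hc.
  pose proof (fixv_value G f x e HG) as Hf.
  transitivity (lapp (lapp (lapp turing_half turing_half) (clo G f (Lam x e))) v).
  { destruct Hv as [_ [s ->]].
    replace (lapp (lapp (lapp turing_half turing_half) (clo G f (Lam x e))) (llam s))
      with (lsubst (lapp (lapp (lapp turing_half turing_half) (clo G f (Lam x e))) (lvar 0))
              0 (llam s)); [apply rt_step, lstep_beta|].
    cbn -[clo]. rewrite (lsubst_value (clo _ _ _)); auto. }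
  assert (E : lreduces (lapp (lapp turing_half turing_half) (clo G f (Lam x e)))
                       (lapp (clo G f (Lam x e)) (fixv G f x e))).
  { transitivity (lapp (llam (lapp (lvar 0)
      (llam (lapp (lapp (lapp turing_half turing_half) (lvar 1)) (lvar 0)))))
      (clo G f (Lam x e))).
    - apply lapp_proper; [|reflexivity]. apply rt_step.
      apply (lstep_beta (llam (lapp (lvar 0)
        (llam (lapp (lapp (lapp (lvar 2) (lvar 2)) (lvar 1)) (lvar 0)))))).
    - destruct Hc as [_ [c Ec]]. unfold fixv. rewrite Ec. apply rt_step.
      apply (lstep_beta (lapp (lvar 0)
        (llam (lapp (lapp (lapp turing_half turing_half) (lvar 1)) (lvar 0))))). }
  rewrite E, clo_beta by auto. rewrite comp_Lam. apply clo_beta; auto.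
  constructor; auto.
Qed.

(** ** Data *)

Definition enc_bool (b : bool) : lterm := if b then ltrue else lfalse.

Definition enc_val (v : val) : lterm :=
  match v with
  | Vzero => scott 2 0 []
  | Vnz s p n => scott 2 1 [enc_bool s; enc_nat p; enc_nat n]
  end.

Fixpoint enc_env (l : list val) : lterm :=
  match l with
  | [] => scott 2 0 []
  | v :: r => scott 2 1 [enc_val v; enc_env r]
  end.

Create HintDb lam.

Ltac ok :=
  unfold venv_ok; repeat first [apply Forall_nil | apply Forall_cons; [cbn [snd]; auto with lam|]].

(** A constructor applied to values is by definition the closure of an
    abstraction over these values; such a closure is a value. *)
Ltac scott_value e G := apply (clo_value G%string "c0"%string e%exp); ok.

Local Open Scope string_scope.
Local Open Scope exp_scope.

Lemma enc_bool_value b : value (enc_bool b).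
Proof.
  destruct b; [scott_value (fn "c1" => "c0") (@nil (string * lterm))|
               scott_value (fn "c1" => "c1") (@nil (string * lterm))].
Qed.

Lemma enc_nat_value n : value (enc_nat n).
Proof.
  induction n.
  - scott_value (fn "c1" => "c0") (@nil (string * lterm)).
  - scott_value (fn "c1" => "c1" @ "a") [("a", enc_nat n)].
Qed.

#[local] Hint Resolve enc_bool_value enc_nat_value : lam.

Lemma enc_val_value v : value (enc_val v).
Proof.
  destruct v as [|s p n].
  - scott_value (fn "c1" => "c0") (@nil (string * lterm)).
  - scott_value (fn "c1" => "c1" @ "a" @ "b" @ "c")
      [("a", enc_bool s); ("b", enc_nat p); ("c", enc_nat n)].
Qed.

#[local] Hint Resolve enc_val_value : lam.

Lemma enc_env_value l : value (enc_env l).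
Proof.
  induction l as [|v l IH].
  - scott_value (fn "c1" => "c0") (@nil (string * lterm)).
  - scott_value (fn "c1" => "c1" @ "a" @ "b") [("a", enc_val v); ("b", enc_env l)].
Qed.

Lemma enc_term_value t : value (enc_term t).
Proof.
  induction t.
  - scott_value (fn "c1" => fn "c2" => fn "c3" => fn "c4" => fn "c5" => "c0" @ "a")
      [("a", enc_nat n)].
  - scott_value (fn "c1" => fn "c2" => fn "c3" => fn "c4" => fn "c5" => "c1")
      (@nil (string * lterm)).
  - scott_value (fn "c1" => fn "c2" => fn "c3" => fn "c4" => fn "c5" => "c2")
      (@nil (string * lterm)).
  - scott_value (fn "c1" => fn "c2" => fn "c3" => fn "c4" => fn "c5" => "c3")
      (@nil (string * lterm)).
  - scott_value (fn "c1" => fn "c2" => fn "c3" => fn "c4" => fn "c5" => "c4" @ "a" @ "b")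
      [("a", enc_term t1); ("b", enc_term t2)].
  - scott_value (fn "c1" => fn "c2" => fn "c3" => fn "c4" => fn "c5" => "c5" @ "a")
      [("a", enc_term t)].
Qed.

#[local] Hint Resolve enc_env_value enc_term_value : lam.

Lemma enc_form_value f : value (enc_form f).
Proof.
  induction f.
  - scott_value (fn "c1" => fn "c2" => fn "c3" => fn "c4" => "c0" @ "a")
      [("a", enc_term t)].
  - scott_value (fn "c1" => fn "c2" => fn "c3" => fn "c4" => "c1" @ "a" @ "b")
      [("a", enc_term t); ("b", enc_term t0)].
  - scott_value (fn "c1" => fn "c2" => fn "c3" => fn "c4" => "c2")
      (@nil (string * lterm)).
  - scott_value (fn "c1" => fn "c2" => fn "c3" => fn "c4" => "c3" @ "a" @ "b")
      [("a", enc_form f1); ("b", enc_form f2)].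
  - scott_value (fn "c1" => fn "c2" => fn "c3" => fn "c4" => "c4" @ "a")
      [("a", enc_form f)].
Qed.

#[local] Hint Resolve enc_form_value : lam.

(** ** Case analysis *)

Ltac val :=
  cbn [snd];
  lazymatch goal with
  | |- value (clo _ _ _) => apply clo_value; val
  | |- venv_ok _ => unfold venv_ok; repeat first [apply Forall_nil | apply Forall_cons; [val|]]
  | |- value _ => first [assumption | solve [auto with lam]]
  end.

Ltac subst_vars :=
  repeat first [rewrite comp_App | rewrite comp_Lam | rewrite comp_Var];
  cbn [lookup String.eqb Ascii.eqb Bool.eqb].

Ltac contract := rewrite clo_beta by val; subst_vars.

Lemma bool_case b u v : value u -> value v ->
  lreduces (lapp (lapp (enc_bool b) u) v) (if b then u else v).
Proof.
  intros Hu Hv. destruct b.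
  - change (enc_bool true) with (clo [] "c0" (fn "c1" => "c0")).
    do 2 contract. reflexivity.
  - change (enc_bool false) with (clo [] "c0" (fn "c1" => "c1")).
    do 2 contract. reflexivity.
Qed.

Lemma nat_case n u v : value u -> value v ->
  lreduces (lapp (lapp (enc_nat n) u) v)
    (match n with O => u | S k => lapp v (enc_nat k) end).
Proof.
  intros Hu Hv. destruct n.
  - change (enc_nat 0) with (clo [] "c0" (fn "c1" => "c0")).
    do 2 contract. reflexivity.
  - change (enc_nat (S n)) with (clo [("a", enc_nat n)] "c0" (fn "c1" => "c1" @ "a")).
    do 2 contract. reflexivity.
Qed.

Lemma val_case w u v : value u -> value v ->
  lreduces (lapp (lapp (enc_val w) u) v)
    (match w with
     | Vzero => u
     | Vnz s p n => lapp (lapp (lapp v (enc_bool s)) (enc_nat p)) (enc_nat n)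
     end).
Proof.
  intros Hu Hv. destruct w as [|s p n].
  - change (enc_val Vzero) with (clo [] "c0" (fn "c1" => "c0")).
    do 2 contract. reflexivity.
  - change (enc_val (Vnz s p n)) with
      (clo [("a", enc_bool s); ("b", enc_nat p); ("c", enc_nat n)] "c0"
         (fn "c1" => "c1" @ "a" @ "b" @ "c")).
    do 2 contract. reflexivity.
Qed.

Lemma env_case l u v : value u -> value v ->
  lreduces (lapp (lapp (enc_env l) u) v)
    (match l with [] => u | w :: r => lapp (lapp v (enc_val w)) (enc_env r) end).
Proof.
  intros Hu Hv. destruct l as [|w r].
  - change (enc_env []) with (clo [] "c0" (fn "c1" => "c0")).
    do 2 contract. reflexivity.
  - change (enc_env (w :: r)) with
      (clo [("a", enc_val w); ("b", enc_env r)] "c0" (fn "c1" => "c1" @ "a" @ "b")).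
    do 2 contract. reflexivity.
Qed.

Lemma term_case t v1 v2 v3 v4 v5 v6 :
  value v1 -> value v2 -> value v3 -> value v4 -> value v5 -> value v6 ->
  lreduces (fold_left lapp [v1; v2; v3; v4; v5; v6] (enc_term t))
    (match t with
     | var n => lapp v1 (enc_nat n)
     | zero => v2
     | one => v3
     | mone => v4
     | mul s u => lapp (lapp v5 (enc_term s)) (enc_term u)
     | inv s => lapp v6 (enc_term s)
     end).
Proof.
  intros. cbn [fold_left].
  set (sel := fun e => fn "c1" => fn "c2" => fn "c3" => fn "c4" => fn "c5" => e).
  destruct t as [n| | | |s u|s].
  - change (enc_term (var n)) with (clo [("a", enc_nat n)] "c0" (sel ("c0" @ "a"))).
    unfold sel. do 6 contract. reflexivity.
  - change (enc_term zero) with (clo [] "c0" (sel "c1")).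
    unfold sel. do 6 contract. reflexivity.
  - change (enc_term one) with (clo [] "c0" (sel "c2")).
    unfold sel. do 6 contract. reflexivity.
  - change (enc_term mone) with (clo [] "c0" (sel "c3")).
    unfold sel. do 6 contract. reflexivity.
  - change (enc_term (mul s u)) with
      (clo [("a", enc_term s); ("b", enc_term u)] "c0" (sel ("c4" @ "a" @ "b"))).
    unfold sel. do 6 contract. reflexivity.
  - change (enc_term (inv s)) with (clo [("a", enc_term s)] "c0" (sel ("c5" @ "a"))).
    unfold sel. do 6 contract. reflexivity.
Qed.

Lemma form_case f v1 v2 v3 v4 v5 :
  value v1 -> value v2 -> value v3 -> value v4 -> value v5 ->
  lreduces (fold_left lapp [v1; v2; v3; v4; v5] (enc_form f))
    (match f with
     | Pos t => lapp v1 (enc_term t)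
     | Eq s t => lapp (lapp v2 (enc_term s)) (enc_term t)
     | Bot => v3
     | Imp g h => lapp (lapp v4 (enc_form g)) (enc_form h)
     | All g => lapp v5 (enc_form g)
     end).
Proof.
  intros. cbn [fold_left].
  set (sel := fun e => fn "c1" => fn "c2" => fn "c3" => fn "c4" => e).
  destruct f as [t|s t| |g h|g].
  - change (enc_form (Pos t)) with (clo [("a", enc_term t)] "c0" (sel ("c0" @ "a"))).
    unfold sel. do 5 contract. reflexivity.
  - change (enc_form (Eq s t)) with
      (clo [("a", enc_term s); ("b", enc_term t)] "c0" (sel ("c1" @ "a" @ "b"))).
    unfold sel. do 5 contract. reflexivity.
  - change (enc_form Bot) with (clo [] "c0" (sel "c2")).
    unfold sel. do 5 contract. reflexivity.
  - change (enc_form (Imp g h)) with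
      (clo [("a", enc_form g); ("b", enc_form h)] "c0" (sel ("c3" @ "a" @ "b"))).
    unfold sel. do 5 contract. reflexivity.
  - change (enc_form (All g)) with (clo [("a", enc_form g)] "c0" (sel ("c4" @ "a"))).
    unfold sel. do 5 contract. reflexivity.
Qed.

(** ** The functions of the evaluation procedure *)

(** Case analysis applies a constructor to all branches, which call-by-value
    would evaluate beforehand.  In recursive functions each branch with a
    recursive call is therefore an abstraction, and further arguments are taken
    after the case analysis. *)

Definition lsucc : lterm := clo [] "n" (fn "z" => fn "s" => "s" @ "n").

Definition ladd : lterm := fixv [("S", lsucc)] "add" "m"
  ("m" @ (fn "n" => "n") @ (fn "k" => fn "n" => "S" @ ("add" @ "k" @ "n"))).

Lemma lsucc_value : value lsucc.
Proof. apply clo_value. ok. Qed.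

#[local] Hint Resolve lsucc_value : lam.

Lemma ladd_value : value ladd.
Proof. apply fixv_value. ok. Qed.

#[local] Hint Resolve ladd_value : lam.

Lemma lsucc_spec n : lreduces (lapp lsucc (enc_nat n)) (enc_nat (S n)).
Proof. unfold lsucc. contract. reflexivity. Qed.

Ltac unfix F := unfold F at 1; rewrite fixv_beta by val; fold F; subst_vars.

Lemma ladd_spec m : forall n,
  lreduces (lapp (lapp ladd (enc_nat m)) (enc_nat n)) (enc_nat (m + n)).
Proof.
  induction m as [|m IH]; intros n; unfix ladd; rewrite nat_case by val.
  - contract. reflexivity.
  - do 2 contract. rewrite IH. apply lsucc_spec.
Qed.

Definition lmul : lterm := fixv [("O", enc_nat 0); ("add", ladd)] "mul" "m"
  ("m" @ (fn "n" => "O") @ (fn "k" => fn "n" => "add" @ "n" @ ("mul" @ "k" @ "n"))).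

Lemma lmul_value : value lmul.
Proof. apply fixv_value. ok. Qed.

#[local] Hint Resolve lmul_value : lam.

Lemma lmul_spec m : forall n,
  lreduces (lapp (lapp lmul (enc_nat m)) (enc_nat n)) (enc_nat (m * n)).
Proof.
  induction m as [|m IH]; intros n; unfix lmul; rewrite nat_case by val.
  - contract. reflexivity.
  - do 2 contract. rewrite IH. apply ladd_spec.
Qed.

Definition lfact : lterm := fixv [("1", enc_nat 1); ("S", lsucc); ("mul", lmul)] "fact" "n"
  ("n" @ "1" @ (fn "k" => "mul" @ "n" @ ("fact" @ "k"))).

Lemma lfact_value : value lfact.
Proof. apply fixv_value. ok. Qed.

#[local] Hint Resolve lfact_value : lam.

Lemma lfact_spec n : lreduces (lapp lfact (enc_nat n)) (enc_nat (fact n)).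
Proof.
  induction n as [|n IH]; unfix lfact; rewrite nat_case by val.
  - reflexivity.
  - contract. rewrite IH. apply lmul_spec.
Qed.

Definition leqn : lterm := fixv [("T", ltrue); ("F", lfalse)] "eqn" "m"
  ("m" @ (fn "n" => "n" @ "T" @ (fn "j" => "F"))
       @ (fn "i" => fn "n" => "n" @ "F" @ (fn "j" => "eqn" @ "i" @ "j"))).

Lemma ltrue_value : value ltrue.
Proof. apply (enc_bool_value true). Qed.

Lemma lfalse_value : value lfalse.
Proof. apply (enc_bool_value false). Qed.

#[local] Hint Resolve ltrue_value lfalse_value : lam.

Lemma leqn_value : value leqn.
Proof. apply fixv_value. ok. Qed.

#[local] Hint Resolve leqn_value : lam.

Lemma leqn_spec m : forall n,
  lreduces (lapp (lapp leqn (enc_nat m)) (enc_nat n)) (enc_bool (Nat.eqb m n)).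
Proof.
  induction m as [|m IH]; intros n; unfix leqn; rewrite nat_case by val.
  - contract. rewrite nat_case by val. destruct n; [reflexivity|].
    contract. reflexivity.
  - do 2 contract. rewrite nat_case by val. destruct n; [reflexivity|].
    contract. apply IH.
Qed.

Definition lnz : lterm :=
  clo [] "b" (fn "p" => fn "n" => fn "z" => fn "c" => "c" @ "b" @ "p" @ "n").

Lemma lnz_value : value lnz.
Proof. apply clo_value. ok. Qed.

#[local] Hint Resolve lnz_value : lam.

Lemma lnz_spec s p n :
  lreduces (lapp (lapp (lapp lnz (enc_bool s)) (enc_nat p)) (enc_nat n))
    (enc_val (Vnz s p n)).
Proof. unfold lnz. do 3 contract. reflexivity. Qed.

Lemma lbool_eq s t :
  lreduces (lapp (lapp (enc_bool s) (enc_bool t))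
             (lapp (lapp (enc_bool t) lfalse) ltrue)) (enc_bool (Bool.eqb s t)).
Proof.
  rewrite (bool_case t lfalse ltrue) by val.
  destruct t; rewrite bool_case by val; destruct s; reflexivity.
Qed.

Definition lvmul : lterm :=
  clo [("0", enc_val Vzero); ("nz", lnz); ("add", ladd); ("T", ltrue); ("F", lfalse)] "v"
  (fn "w" => "v" @ "0" @ (fn "s" => fn "p" => fn "n" =>
     "w" @ "0" @ (fn "t" => fn "q" => fn "m" =>
       "nz" @ ("s" @ "t" @ ("t" @ "F" @ "T")) @ ("add" @ "p" @ "q") @ ("add" @ "n" @ "m")))).

Lemma lvmul_value : value lvmul.
Proof. apply clo_value. ok. Qed.

#[local] Hint Resolve lvmul_value : lam.

Lemma lvmul_spec v w :
  lreduces (lapp (lapp lvmul (enc_val v)) (enc_val w)) (enc_val (vmul v w)).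
Proof.
  unfold lvmul. do 2 contract. rewrite val_case by val.
  destruct v as [|s p n]; [reflexivity|]. do 3 contract. rewrite val_case by val.
  destruct w as [|t q m]; [reflexivity|]. do 3 contract.
  rewrite lbool_eq, !ladd_spec. apply lnz_spec.
Qed.

Definition lvinv : lterm :=
  clo [("0", enc_val Vzero); ("nz", lnz)] "v"
  ("v" @ "0" @ (fn "s" => fn "p" => fn "n" => "nz" @ "s" @ "n" @ "p")).

Lemma lvinv_value : value lvinv.
Proof. apply clo_value. ok. Qed.

#[local] Hint Resolve lvinv_value : lam.

Lemma lvinv_spec v : lreduces (lapp lvinv (enc_val v)) (enc_val (vinv v)).
Proof.
  unfold lvinv. contract. rewrite val_case by val.
  destruct v as [|s p n]; [reflexivity|]. do 3 contract. apply lnz_spec.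
Qed.

Definition lveq : lterm :=
  clo [("add", ladd); ("eqn", leqn); ("T", ltrue); ("F", lfalse)] "v"
  (fn "w" => "v" @ ("w" @ "T" @ (fn "t" => fn "q" => fn "m" => "F"))
     @ (fn "s" => fn "p" => fn "n" => "w" @ "F" @ (fn "t" => fn "q" => fn "m" =>
          "s" @ "t" @ ("t" @ "F" @ "T")
              @ ("eqn" @ ("add" @ "p" @ "m") @ ("add" @ "q" @ "n")) @ "F"))).

Lemma lveq_value : value lveq.
Proof. apply clo_value. ok. Qed.

#[local] Hint Resolve lveq_value : lam.

Lemma lveq_spec v w :
  lreduces (lapp (lapp lveq (enc_val v)) (enc_val w)) (enc_bool (veqb v w)).
Proof.
  unfold lveq. do 2 contract. rewrite (val_case w ltrue) by val.
  destruct w as [|t q m].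
  - rewrite val_case by val. destruct v as [|s p n]; [reflexivity|].
    do 3 contract. rewrite val_case by val. reflexivity.
  - do 3 contract. rewrite val_case by val. destruct v as [|s p n]; [reflexivity|].
    do 3 contract. rewrite val_case by val. do 3 contract.
    rewrite lbool_eq, !ladd_spec, leqn_spec, bool_case by val.
    simpl. destruct (Bool.eqb s t); reflexivity.
Qed.

Definition lvpos : lterm :=
  clo [("F", lfalse)] "v" ("v" @ "F" @ (fn "s" => fn "p" => fn "n" => "s")).

Lemma lvpos_value : value lvpos.
Proof. apply clo_value. ok. Qed.

#[local] Hint Resolve lvpos_value : lam.

Lemma lvpos_spec v : lreduces (lapp lvpos (enc_val v)) (enc_bool (vpos v)).
Proof.
  unfold lvpos. contract. rewrite val_case by val.
  destruct v as [|s p n]; [reflexivity|]. do 3 contract. reflexivity.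
Qed.

Definition lvscale : lterm :=
  clo [("0", enc_val Vzero); ("nz", lnz); ("mul", lmul)] "k"
  (fn "v" => "v" @ "0" @ (fn "s" => fn "p" => fn "n" =>
     "nz" @ "s" @ ("mul" @ "k" @ "p") @ ("mul" @ "k" @ "n"))).

Lemma lvscale_value : value lvscale.
Proof. apply clo_value. ok. Qed.

#[local] Hint Resolve lvscale_value : lam.

Lemma lvscale_spec k v :
  lreduces (lapp (lapp lvscale (enc_nat k)) (enc_val v)) (enc_val (vscale k v)).
Proof.
  unfold lvscale. do 2 contract. rewrite val_case by val.
  destruct v as [|s p n]; [reflexivity|]. do 3 contract.
  rewrite !lmul_spec. apply lnz_spec.
Qed.

Definition lvsize : lterm :=
  clo [("O", enc_nat 0); ("add", ladd)] "v"
  ("v" @ "O" @ (fn "s" => fn "p" => fn "n" => "add" @ "p" @ "n")).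

Lemma lvsize_value : value lvsize.
Proof. apply clo_value. ok. Qed.

#[local] Hint Resolve lvsize_value : lam.

Lemma lvsize_spec v : lreduces (lapp lvsize (enc_val v)) (enc_nat (vsize v)).
Proof.
  unfold lvsize. contract. rewrite val_case by val.
  destruct v as [|s p n]; [reflexivity|]. do 3 contract. apply ladd_spec.
Qed.

Definition lcons : lterm := clo [] "v" (fn "l" => fn "z" => fn "c" => "c" @ "v" @ "l").

Lemma lcons_value : value lcons.
Proof. apply clo_value. ok. Qed.

#[local] Hint Resolve lcons_value : lam.

Lemma lcons_spec v l :
  lreduces (lapp (lapp lcons (enc_val v)) (enc_env l)) (enc_env (v :: l)).
Proof. unfold lcons. do 2 contract. reflexivity. Qed.

Definition lget : lterm := fixv [("0", enc_val Vzero)] "get" "n"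
  ("n" @ (fn "l" => "l" @ "0" @ (fn "v" => fn "r" => "v"))
       @ (fn "k" => fn "l" => "l" @ "0" @ (fn "v" => fn "r" => "get" @ "k" @ "r"))).

Lemma lget_value : value lget.
Proof. apply fixv_value. ok. Qed.

#[local] Hint Resolve lget_value : lam.

Lemma lget_spec n : forall l,
  lreduces (lapp (lapp lget (enc_nat n)) (enc_env l)) (enc_val (env_get n l)).
Proof.
  induction n as [|n IH]; intros l; unfix lget; rewrite nat_case by val.
  - contract. rewrite env_case by val. destruct l; [reflexivity|].
    do 2 contract. reflexivity.
  - do 2 contract. rewrite env_case by val. destruct l; [reflexivity|].
    do 2 contract. apply IH.
Qed.

Definition lescale : lterm :=
  fixv [("nil", enc_env []); ("cons", lcons); ("scale", lvscale)] "esc" "l"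
  ("l" @ (fn "k" => "nil") @ (fn "v" => fn "r" => fn "k" =>
     "cons" @ ("scale" @ "k" @ "v") @ ("esc" @ "r" @ "k"))).

Lemma lescale_value : value lescale.
Proof. apply fixv_value. ok. Qed.

#[local] Hint Resolve lescale_value : lam.

Lemma lescale_spec k l :
  lreduces (lapp (lapp lescale (enc_env l)) (enc_nat k)) (enc_env (env_scale k l)).
Proof.
  induction l as [|v l IH]; unfix lescale; rewrite env_case by val.
  - contract. reflexivity.
  - do 3 contract. rewrite lvscale_spec, IH. apply lcons_spec.
Qed.

Definition lesize : lterm :=
  fixv [("O", enc_nat 0); ("add", ladd); ("size", lvsize)] "esz" "l"
  ("l" @ "O" @ (fn "v" => fn "r" => "add" @ ("size" @ "v") @ ("esz" @ "r"))).

Lemma lesize_value : value lesize.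
Proof. apply fixv_value. ok. Qed.

#[local] Hint Resolve lesize_value : lam.

Lemma lesize_spec l : lreduces (lapp lesize (enc_env l)) (enc_nat (env_size l)).
Proof.
  induction l as [|v l IH]; unfix lesize; rewrite env_case by val.
  - reflexivity.
  - do 2 contract. rewrite lvsize_spec, IH. apply ladd_spec.
Qed.

Definition ltev : lterm :=
  fixv [("get", lget); ("vzero", enc_val Vzero); ("vone", enc_val (Vnz true 0 0));
        ("vmone", enc_val (Vnz false 0 0)); ("vmul", lvmul); ("vinv", lvinv)] "tev" "t"
  ("t" @ (fn "n" => fn "e" => "get" @ "n" @ "e")
       @ (fn "e" => "vzero") @ (fn "e" => "vone") @ (fn "e" => "vmone")
       @ (fn "s" => fn "u" => fn "e" => "vmul" @ ("tev" @ "s" @ "e") @ ("tev" @ "u" @ "e"))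
       @ (fn "s" => fn "e" => "vinv" @ ("tev" @ "s" @ "e"))).

Lemma ltev_value : value ltev.
Proof. apply fixv_value. ok. Qed.

#[local] Hint Resolve ltev_value : lam.

Ltac use_case L := etransitivity;
  [apply lapp_proper; [apply L; val|reflexivity]|]; cbv beta iota.

Lemma ltev_spec t l :
  lreduces (lapp (lapp ltev (enc_term t)) (enc_env l)) (enc_val (tev t l)).
Proof.
  induction t as [n| | | |s IHs u IHu|s IHs]; unfix ltev; use_case term_case.
  - do 2 contract. apply lget_spec.
  - contract. reflexivity.
  - contract. reflexivity.
  - contract. reflexivity.
  - do 3 contract. rewrite IHs, IHu. apply lvmul_spec.
  - do 2 contract. rewrite IHs. apply lvinv_spec.
Qed.

Definition ltsize : lterm :=
  fixv [("O", enc_nat 0); ("1", enc_nat 1); ("add", ladd)] "size" "t"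
  ("t" @ (fn "n" => "1") @ "O" @ "O" @ "O"
       @ (fn "s" => fn "u" => "add" @ ("size" @ "s") @ ("size" @ "u"))
       @ (fn "s" => "size" @ "s")).

Lemma ltsize_value : value ltsize.
Proof. apply fixv_value. ok. Qed.

#[local] Hint Resolve ltsize_value : lam.

Lemma ltsize_spec t : lreduces (lapp ltsize (enc_term t)) (enc_nat (tsize t)).
Proof.
  induction t as [n| | | |s IHs u IHu|s IHs]; unfix ltsize;
    (etransitivity; [apply term_case; val|]); cbv beta iota.
  - contract. reflexivity.
  - reflexivity.
  - reflexivity.
  - reflexivity.
  - do 2 contract. rewrite IHs, IHu. apply ladd_spec.
  - contract. apply IHs.
Qed.

Definition lrank : lterm :=
  fixv [("O", enc_nat 0); ("size", ltsize); ("add", ladd); ("mul", lmul)] "rank" "f"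
  ("f" @ (fn "t" => "O")
       @ (fn "s" => fn "t" => "add" @ ("size" @ "s") @ ("size" @ "t"))
       @ "O"
       @ (fn "g" => fn "h" => "add" @ ("rank" @ "g") @ ("rank" @ "h"))
       @ (fn "g" => (fn "N" => "mul" @ "N" @ ("add" @ "N" @ "N")) @ ("rank" @ "g"))).

Lemma lrank_value : value lrank.
Proof. apply fixv_value. ok. Qed.

#[local] Hint Resolve lrank_value : lam.

Lemma lrank_spec f : lreduces (lapp lrank (enc_form f)) (enc_nat (rank f)).
Proof.
  induction f as [t|s t| |g IHg h IHh|g IHg]; unfix lrank;
    (etransitivity; [apply form_case; val|]); cbv beta iota.
  - contract. reflexivity.
  - do 2 contract. rewrite !ltsize_spec. apply ladd_spec.
  - reflexivity.
  - do 2 contract. rewrite IHg, IHh. apply ladd_spec.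
  - contract. rewrite IHg. contract. rewrite ladd_spec. apply lmul_spec.
Qed.

Definition lall : lterm := fixv [("T", ltrue); ("F", lfalse)] "all" "n"
  ("n" @ (fn "p" => "T")
       @ (fn "k" => fn "p" => ("p" @ "k") @ ("all" @ "k" @ "p") @ "F")).

Lemma lall_value : value lall.
Proof. apply fixv_value. ok. Qed.

#[local] Hint Resolve lall_value : lam.

Lemma lall_spec (P : lterm) (p : nat -> bool) n :
  value P -> (forall k, lreduces (lapp P (enc_nat k)) (enc_bool (p k))) ->
  lreduces (lapp (lapp lall (enc_nat n)) P) (enc_bool (all_below n p)).
Proof.
  intros HP Hp. induction n as [|n IH]; unfix lall; rewrite nat_case by val.
  - contract. reflexivity.
  - do 2 contract. rewrite Hp, IH, bool_case by val.
    simpl. destruct (p n); reflexivity.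
Qed.

Definition lev : lterm :=
  fixv [("F", lfalse); ("T", ltrue); ("tev", ltev); ("vpos", lvpos); ("veq", lveq);
        ("rank", lrank); ("fact", lfact); ("scale", lescale); ("size", lesize);
        ("S", lsucc); ("mul", lmul); ("cons", lcons); ("vzero", enc_val Vzero);
        ("nz", lnz); ("all", lall)] "ev" "f"
  ("f" @ (fn "t" => fn "e" => "vpos" @ ("tev" @ "t" @ "e"))
       @ (fn "s" => fn "t" => fn "e" => "veq" @ ("tev" @ "s" @ "e") @ ("tev" @ "t" @ "e"))
       @ (fn "e" => "F")
       @ (fn "g" => fn "h" => fn "e" => ("ev" @ "g" @ "e") @ ("ev" @ "h" @ "e") @ "T")
       @ (fn "g" => fn "e0" =>
           (fn "N" => (fn "e" => (fn "B" =>
              ("ev" @ "g" @ ("cons" @ "vzero" @ "e"))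
              @ ("all" @ "B" @ (fn "p" => "all" @ "B" @ (fn "n" =>
                   ("ev" @ "g" @ ("cons" @ ("nz" @ "T" @ "p" @ "n") @ "e"))
                   @ ("ev" @ "g" @ ("cons" @ ("nz" @ "F" @ "p" @ "n") @ "e"))
                   @ "F")))
              @ "F")
             @ ("S" @ ("S" @ ("mul" @ "N" @ ("size" @ "e")))))
            @ ("scale" @ "e0" @ ("fact" @ "N")))
           @ ("rank" @ "g"))).

Lemma lev_value : value lev.
Proof. apply fixv_value. ok. Qed.

#[local] Hint Resolve lev_value : lam.

Lemma lev_spec f : forall l,
  lreduces (lapp (lapp lev (enc_form f)) (enc_env l)) (enc_bool (ev f l)).
Proof.
  induction f as [t|s t| |g IHg h IHh|g IHg]; intros l; unfix lev; use_case form_case.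
  - do 2 contract. rewrite ltev_spec. apply lvpos_spec.
  - do 3 contract. rewrite !ltev_spec. apply lveq_spec.
  - contract. reflexivity.
  - do 3 contract. rewrite IHg, IHh, bool_case by val. simpl.
    destruct (ev g l), (ev h l); reflexivity.
  - do 2 contract. rewrite lrank_spec. contract.
    rewrite lfact_spec, lescale_spec. contract.
    rewrite lesize_spec, lmul_spec, !lsucc_spec. contract.
    set (e := env_scale (fact (rank g)) l).
    set (B := S (S (rank g * env_size e))).
    rewrite lcons_spec, IHg.
    rewrite (lall_spec _ (fun p => all_below B (fun n =>
               andb (ev g (Vnz true p n :: e)) (ev g (Vnz false p n :: e))))).
    + rewrite bool_case by val. cbn [ev]. fold e. fold B.
      destruct (ev g (Vzero :: e)); reflexivity.
    + val.
    + intros p. contract. apply lall_spec; [val|].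
      intros n. contract. change ltrue with (enc_bool true). change lfalse with (enc_bool false).
      rewrite !lnz_spec, !lcons_spec, !IHg, bool_case by val.
      destruct (ev g (Vnz true p n :: e)); reflexivity.
Qed.

Definition ldecide : lterm := clo [("ev", lev); ("nil", enc_env [])] "f" ("ev" @ "f" @ "nil").

Lemma ldecide_spec f : lreduces (lapp ldecide (enc_form f)) (enc_bool (ev f [])).
Proof. unfold ldecide. contract. apply lev_spec. Qed.

Theorem mul_axioms_decidable : decidable_theory mul_axioms.
Proof.
  exists ldecide. split.
  - apply clo_value. ok.
  - intros f Hf. pose proof (ldecide_spec f) as H. rewrite (proves_iff_ev f Hf).
    destruct (ev f []); split; intros E; try exact H; congruence.
Qed.

Theorem theorem3p3 :
  completely_axiomatizes mul_axioms R_struct /\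
  admits_QE mul_axioms /\
  decidable_theory mul_axioms.
Proof.
  split; [exact mul_axioms_complete|].
  split; [exact mul_axioms_QE|exact mul_axioms_decidable].
Qed.
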